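(* Let $Q$ be a simply laced quiver, let $\Delta=(A,M)$ be a $Q$-set all of whose composition maps $\alpha$ are zero, and let $\Lambda_\Delta=A\oplus M$ be the corresponding $k$-algebra arising from a $k$-category with zero compositions. Consider the maps $$\iota_n:\bigoplus_{\delta\in DQ_{\leq n}}\mathsf{H}^n_\delta(\Delta)\to\mathsf{HH}^n(\Lambda_\Delta),\qquad \pi_n:\mathsf{HH}^n(\Lambda_\Delta)\to\mathsf{HH}^n(A)\oplus\bigoplus_{\gamma\in CQ_{\leq n},\ \gamma\notin Q_0}\mathsf{H}^n_\gamma(\Delta)$$ of the cohomology long exact sequence induced by the short exact sequence of complexes $0\to\mathsf D^\bullet\to\mathsf J^\bullet\to(\mathsf J/\mathsf D)^\bullet\to0$ described in the context. Then: 1. The cup product of $\mathsf{HH}^\bullet(\Lambda_\Delta)$ restricted to the images of the maps $\iota_n$ is zero; in other words, the cup product vanishes on cocycles which belong to $\mathsf D^\bullet$. 2. The family of maps $(\pi_n)_{n\ge0}$ is a graded algebra map, where $\mathsf{HH}^\bullet(A)\oplus\bigoplus_{\gamma\in CQ,\ \gamma\notin Q_0}\mathsf{H}^\bullet_\gamma(\Delta)=\bigoplus_{\gamma\in CQ}\mathsf{H}^\bullet_\gamma(\Delta)$ has the cup product along paths.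
   Context: $k$ is a field; algebras are nonzero associative unital $k$-algebras, not necessarily finite dimensional; $\otimes=\otimes_k$; $\mathsf{HH}^n(\Lambda)=\mathsf{Ext}^n_{\Lambda\otimes\Lambda^{op}}(\Lambda,\Lambda)$. **$Q$-sets.** A (finite) quiver $Q$ has a finite set $Q_0$ of vertices, a finite set $Q_1$ of arrows and source and target maps $s,t:Q_1\to Q_0$. It is simply laced if it has no loops and at most one arrow from any vertex to any other. A $Q$-set $\Delta$ consists of an algebra $A_x$ for each $x\in Q_0$; a nonzero $A_{t(a)}$-$A_{s(a)}$-bimodule $M_a={}_{t(a)}M_{s(a)}$ for each $a\in Q_1$ (put ${}_yM_x=0$ if $x\ne y$ and there is no arrow from $x$ to $y$, and ${}_xM_x=A_x$); and bimodule maps $\alpha_{z,y,x}:{}_zM_y\otimes_{A_y}{}_yM_x\to{}_zM_x$ for $x\neq y\neq z$ satisfying the associativity constraints. Put $A=\times_{x}A_x$, $M=\oplus_{a}M_a$ (an $A$-bimodule, actions extended by zero). $\Lambda_\Delta=A\oplus M$ is the algebra whose product is given by the product of $A$, the bimodule structure of $M$, and the maps $\alpha$ on $M\times M$. If all maps $\alpha$ are zero (so $M^2=0$), $\Lambda_\Delta$ is said to arise from a $k$-category with zero compositions. Let $e_x$ be the unit of $A_x$ and $D=\times_{x\in Q_0}ke_x\subset A$. **Paths and trajectories.** A path of length $m>0$ is $\omega=a_m\cdots a_1$ with $a_i\in Q_1$, $t(a_i)=s(a_{i+1})$; $s(\omega)=s(a_1)$, $t(\omega)=t(a_m)$. Vertices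 are the paths of length $0$. A path is a cycle if $s(\omega)=t(\omega)$ (so vertices are cycles); $CQ$ and $DQ$ are the sets of cycles and of non cycles; the subscript $\leq n$ means length at most $n$. $\Delta_\omega=e_{t(\omega)}\Lambda_\Delta e_{s(\omega)}$. A trajectory of duration $n$ over $\omega=a_m\cdots a_1$ is a sequence $\tau=t(a_m)^{p_{m+1}},a_m,s(a_m)^{p_m},\dots,s(a_2)^{p_2},a_1,s(a_1)^{p_1}$ with integers $p_i\ge0$ (waiting times) and $n=m+\sum_ip_i$; $x^p$ means $x$ repeated $p$ times. For a vertex $x$, the only trajectory of duration $n$ over $x$ is $x^n$. $T_n(\omega)$ is the set of trajectories of duration $n$ over $\omega$. Put $\tau_\Delta=A_{t(a_m)}^{\otimes p_{m+1}}\otimes M_{a_m}\otimes A_{s(a_m)}^{\otimes p_m}\otimes\cdots\otimes M_{a_1}\otimes A_{s(a_1)}^{\otimes p_1}$ and $(x^n)_\Delta=A_x^{\otimes n}$ ($A_x^{\otimes0}=k$). $\tau_0^+$ is the set of trajectories of duration $n+1$ obtained from $\tau\in T_n(\omega)$ by increasing one waiting time by one. **Complexes.** $\mathsf J^\bullet$ is the complex with $\mathsf J^0=\Lambda_\Delta^D$ (centralizer of $D$), $\mathsf J^n=\mathsf{Hom}_{D-D}(\Lambda_\Delta^{\otimes_Dn},\Lambda_\Delta)$ and the usual Hochschild coboundary $d$; its cohomology is $\mathsf{HH}^\bullet(\Lambda_\Delta)$. One has $\Lambda_\Delta^{\otimes_Dn}=\bigoplus_\omega\bigoplus_{\tau\in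 T_n(\omega)}\tau_\Delta$, so $\mathsf J^n=\bigoplus_\omega\mathsf J^n_\omega$ with $\mathsf J^n_\omega=\bigoplus_{\tau\in T_n(\omega)}\mathsf{Hom}_k(\tau_\Delta,\Delta_\omega)$. With zero compositions, $\mathsf D^n=\bigoplus_{\delta\in DQ}\mathsf J^n_\delta$ is a subcomplex of $\mathsf J^\bullet$. For any path $\omega$, $\mathsf H^\bullet_\omega(\Delta)$ is the cohomology of $\mathsf K_\omega^n=\mathsf J_\omega^n$ with differential $\mathsf df_\tau=\sum_{\sigma\in\tau_0^+}(df_\tau)_\sigma$, $(\ )_\sigma$ being the component in $\mathsf{Hom}_k(\sigma_\Delta,\Delta_\omega)$. For a vertex $x$, $\mathsf H^n_x(\Delta)=\mathsf{HH}^n(A_x)$, hence $\bigoplus_{x\in Q_0}\mathsf H_x^n(\Delta)=\mathsf{HH}^n(A)$. One has $\mathsf H^n(\mathsf D^\bullet)=\bigoplus_{\delta\in DQ_{\le n}}\mathsf H_\delta^n(\Delta)$ and, identifying $(\mathsf J/\mathsf D)^n$ with $\bigoplus_{\gamma\in CQ}\mathsf J_\gamma^n$, $\mathsf H^n((\mathsf J/\mathsf D)^\bullet)=\bigoplus_{\gamma\in CQ_{\le n}}\mathsf H_\gamma^n(\Delta)$. **Cup products.** On $\mathsf J^\bullet$, $f'\smile f$ is $\Lambda_\Delta^{\otimes_D(n'+n)}\xrightarrow{f'\otimes_Df}\Lambda_\Delta\otimes_D\Lambda_\Delta\to\Lambda_\Delta$, inducing the cup product of $\mathsf{HH}^\bullet(\Lambda_\Delta)$.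 Along paths: for $f'_{\tau'}:\tau'_\Delta\to\Delta_{\omega'}$ and $f_\tau:\tau_\Delta\to\Delta_\omega$ with $\tau',\tau$ trajectories over $\omega',\omega$, $f'_{\tau'}\smile f_\tau=0$ if $s(\omega')\ne t(\omega)$, and otherwise it is the composition $(\tau'\tau)_\Delta=\tau'_\Delta\otimes\tau_\Delta\xrightarrow{f'_{\tau'}\otimes f_\tau}\Delta_{\omega'}\otimes\Delta_\omega\to\Delta_{\omega'\omega}$ (product of $\Lambda_\Delta$), where $\tau'\tau$ is the concatenated trajectory over $\omega'\omega$; it induces $\mathsf H^{n'}_{\omega'}(\Delta)\otimes\mathsf H^n_\omega(\Delta)\to\mathsf H^{n'+n}_{\omega'\omega}(\Delta)$. *)

(* Defs.v *)
From HB Require Import structures.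
From mathcomp Require Import all_boot all_order all_algebra generic_quotient ring_quotient.
From mathcomp Require Import boolp functions.

Set Implicit Arguments.
Unset Strict Implicit.
Unset Printing Implicit Defensive.

Import GRing.Theory.
Local Open Scope ring_scope.
Local Open Scope quotient_scope.

(* All index types below are finite, so this is also the direct sum. *)
Definition dprod (k : fieldType) (I : finType) (V : I -> lmodType k) : Type :=
  forall i, V i.

Section DProd.
Variables (k : fieldType) (I : finType) (V : I -> lmodType k).
Implicit Types u v w : dprod V.

HB.instance Definition _ := Choice.copy (dprod V) (forall i, V i).

Definition dprod_zero : dprod V := fun=> 0.
Definition dprod_opp u : dprod V := fun i => - u i.
Definition dprod_add u v : dprod V := fun i => u i + v i.
Definition dprod_scale (c : k) u : dprod V := fun i => c *: u i.

Fact dprod_addA : associative dprod_add.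
Proof. by move=> u v w; apply: functional_extensionality_dep => i; apply: addrA. Qed.
Fact dprod_addC : commutative dprod_add.
Proof. by move=> u v; apply: functional_extensionality_dep => i; apply: addrC. Qed.
Fact dprod_add0 : left_id dprod_zero dprod_add.
Proof. by move=> u; apply: functional_extensionality_dep => i; apply: add0r. Qed.
Fact dprod_addN : left_inverse dprod_zero dprod_opp dprod_add.
Proof. by move=> u; apply: functional_extensionality_dep => i; apply: addNr. Qed.
HB.instance Definition _ := GRing.isZmodule.Build (dprod V)
  dprod_addA dprod_addC dprod_add0 dprod_addN.

Fact dprod_scaleA a b u : dprod_scale a (dprod_scale b u) = dprod_scale (a * b) u.
Proof. by apply: functional_extensionality_dep => i; apply: scalerA. Qed.
Fact dprod_scale1 : left_id 1 dprod_scale.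
Proof. by move=> u; apply: functional_extensionality_dep => i; apply: scale1r. Qed.
Fact dprod_scaleDr : right_distributive dprod_scale +%R.
Proof. by move=> c u v; apply: functional_extensionality_dep => i; apply: scalerDr. Qed.
Fact dprod_scaleDl u : {morph dprod_scale^~ u : a b / a + b}.
Proof. by move=> a b; apply: functional_extensionality_dep => i; apply: scalerDl. Qed.
HB.instance Definition _ := GRing.Zmodule_isLmodule.Build k (dprod V)
  dprod_scaleA dprod_scale1 dprod_scaleDr dprod_scaleDl.

Lemma dprodP u v : (forall i, u i = v i) -> u = v.
Proof. exact: functional_extensionality_dep. Qed.

Lemma dprod_sumE (J : Type) (r : seq J) (P : pred J) (F : J -> dprod V) i :
  (\sum_(j <- r | P j) F j) i = \sum_(j <- r | P j) F j i.
Proof. by elim/big_rec2: _ => // j x y _ <-. Qed.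

Definition dinj (i : I) (x : V i) : dprod V :=
  dfwith (fun j => 0 : V j) x.

Lemma dinj_sum u : u = \sum_i dinj (u i).
Proof.
apply: dprodP => i; rewrite dprod_sumE (bigD1 i) //= big1 ?addr0 ?/dinj ?dfwith_in //.
by move=> j ne_ji; rewrite dfwith_out.
Qed.

End DProd.

Record subspace (k : fieldType) (V : lmodType k) := Subspace {
  subspace_mem :> V -> Prop;
  subspace_0 : subspace_mem 0;
  subspace_lin : forall c u v,
    subspace_mem u -> subspace_mem v -> subspace_mem (c *: u + v) }.

Section Subquotient.
Variables (k : fieldType) (V : lmodType k) (Z B : subspace V).

Definition sub_pred : {pred V} := fun v => `[< Z v >].
Fact sub_pred_closed : submod_closed sub_pred.
Proof.
split; first by apply/asboolP; apply: subspace_0.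
by move=> c u v /asboolP Zu /asboolP Zv; apply/asboolP; apply: subspace_lin.
Qed.
HB.instance Definition _ := GRing.isSubmodClosed.Build k V sub_pred
  (GRing.submod_closed_semi sub_pred_closed).

Definition sub_type : Type := {v : V | v \in sub_pred}.
HB.instance Definition _ := SubChoice.on sub_type.
HB.instance Definition _ := [SubChoice_isSubLmodule of sub_type by <:].

Definition bnd_pred : {pred sub_type} := fun z => `[< B (val z) >].
Fact bnd_pred_closed : submod_closed bnd_pred.
Proof.
split; first by apply/asboolP; rewrite raddf0; apply: subspace_0.
move=> c u v /asboolP Bu /asboolP Bv; apply/asboolP.
by rewrite linearP; apply: subspace_lin.
Qed.
HB.instance Definition _ := GRing.isSubmodClosed.Build k sub_type bnd_pred
  (GRing.submod_closed_semi bnd_pred_closed).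

(* Z / (Z :&: B) *)
Definition subquo : Type := Quotient.quot bnd_pred.
HB.instance Definition _ := GRing.Zmodule.on subquo.

Definition subquo_pi (z : sub_type) : subquo := \pi_(Quotient.quot bnd_pred) z.
Definition subquo_repr (h : subquo) : sub_type := repr (h : Quotient.quot bnd_pred).

Lemma subquo_reprK h : subquo_pi (subquo_repr h) = h.
Proof. exact: reprK. Qed.

Lemma subquo_piP x y : subquo_pi x = subquo_pi y <-> B (val (x - y)).
Proof.
split=> [/eqP|Bxy]; first by rewrite -Quotient.idealrBE => /asboolP.
by apply/eqP; rewrite -Quotient.idealrBE; apply/asboolP.
Qed.

Lemma subquo_piD x y : subquo_pi (x + y) = subquo_pi x + subquo_pi y.
Proof. by rewrite /subquo_pi !piE. Qed.

Definition subquo_scale (c : k) (h : subquo) : subquo := subquo_pi (c *: subquo_repr h).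

Lemma subquo_piZ c x : subquo_pi (c *: x) = subquo_scale c (subquo_pi x).
Proof.
apply/subquo_piP; rewrite -scalerBr linearZ /= -[_ *: _]addr0.
apply: subspace_lin; last exact: subspace_0.
by apply/subquo_piP; rewrite subquo_reprK.
Qed.

Fact subquo_scaleA a b h : subquo_scale a (subquo_scale b h) = subquo_scale (a * b) h.
Proof. by rewrite -[h]subquo_reprK -!subquo_piZ scalerA. Qed.
Fact subquo_scale1 : left_id 1 subquo_scale.
Proof. by move=> h; rewrite -[h]subquo_reprK -!subquo_piZ scale1r. Qed.
Fact subquo_scaleDr : right_distributive subquo_scale +%R.
Proof.
move=> c g h; rewrite -[g]subquo_reprK -[h]subquo_reprK.
by rewrite -subquo_piD -!subquo_piZ scalerDr subquo_piD.
Qed.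
Fact subquo_scaleDl h : {morph subquo_scale^~ h : a b / a + b}.
Proof. by move=> a b; rewrite -[h]subquo_reprK -!subquo_piZ scalerDl subquo_piD. Qed.
HB.instance Definition _ := GRing.Zmodule_isLmodule.Build k subquo
  subquo_scaleA subquo_scale1 subquo_scaleDr subquo_scaleDl.

End Subquotient.

(* Cohomology of the quotient of a cochain complex (P, d) by a subcomplex R,
   where P^n and R^n are subspaces of an ambient space V n on which d is
   defined; for R = 0 this is the cohomology of (P, d).  A class of P^n/R^n is
   represented by an element of P^n. *)
Section Cohomology.
Variables (k : fieldType) (V : nat -> lmodType k).
Variables (d : forall n, {linear V n -> V n.+1}) (P R : forall n, subspace (V n)).

Definition cocycle n (f : V n) : Prop := P n f /\ R n.+1 (d n f).

Definition coboundary n : V n -> Prop :=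
  match n with
  | 0 => fun f => R 0 f
  | n'.+1 => fun f => exists2 g, P n' g & R n'.+1 (f - d n' g)
  end.

Fact cocycle_0 n : cocycle (0 : V n).
Proof. by split; [exact: (subspace_0 (P n)) | rewrite linear0; exact: (subspace_0 (R n.+1))]. Qed.
Fact cocycle_lin n c (u v : V n) : cocycle u -> cocycle v -> cocycle (c *: u + v).
Proof.
by move=> [Pu Ru] [Pv Rv]; split; last rewrite linearP; apply: subspace_lin.
Qed.
Definition cocycles n : subspace (V n) := Subspace (@cocycle_0 n) (@cocycle_lin n).

Fact coboundary_0 n : coboundary (0 : V n).
Proof.
case: n => [|n] /=; first exact: subspace_0.
exists 0; first exact: subspace_0.
by rewrite linear0 subrr; apply: subspace_0.
Qed.
Fact coboundary_lin n c (u v : V n) :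
  coboundary u -> coboundary v -> coboundary (c *: u + v).
Proof.
case: n u v => [|n] u v /=; first exact: subspace_lin.
move=> [g Pg Rg] [h Ph Rh]; exists (c *: g + h); first exact: subspace_lin.
by rewrite linearP opprD addrACA -scalerBr; apply: subspace_lin.
Qed.
Definition coboundaries n : subspace (V n) :=
  Subspace (@coboundary_0 n) (@coboundary_lin n).

Definition cohom n : Type := subquo (cocycles n) (coboundaries n).
HB.instance Definition _ n := GRing.Lmodule.on (cohom n).

(* the class of a cocycle f (and 0 if f is not a cocycle) *)
Definition hclass n (f : V n) : cohom n :=
  subquo_pi (coboundaries n) (insubd (0 : sub_type (cocycles n)) f).

Definition hrep n (h : cohom n) : V n := val (subquo_repr h).

Lemma hrep_cocycle n (h : cohom n) : cocycle (hrep h).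
Proof. by apply/asboolP; exact: valP (subquo_repr h). Qed.

Lemma hrepK n (h : cohom n) : hclass (hrep h) = h.
Proof. by rewrite /hclass valKd; apply: subquo_reprK. Qed.

Lemma hclassP n (f g : V n) : cocycle f -> cocycle g ->
  hclass f = hclass g <-> coboundary (f - g).
Proof.
move=> /asboolP Zf /asboolP Zg; rewrite /hclass (subquo_piP (coboundaries n)).
by rewrite raddfB /= !insubdK.
Qed.

End Cohomology.

Section ZeroSubspace.
Variables (k : fieldType) (V : lmodType k).
Fact zero_subspace_lin (c : k) (u v : V) : u = 0 -> v = 0 -> c *: u + v = 0.
Proof. by move=> -> ->; rewrite scaler0 addr0. Qed.
Definition zero_subspace : subspace V := Subspace (erefl 0) zero_subspace_lin.
End ZeroSubspace.

Record quiver := Quiver {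
  vert : finType;
  arr : finType;
  src : arr -> vert;
  tgt : arr -> vert }.

Definition simply_laced (Q : quiver) : Prop :=
  (forall a : arr Q, src a <> tgt a) /\
  (forall a b : arr Q, src a = src b -> tgt a = tgt b -> a = b).

(* B-C-bimodules over k-algebras, k acting centrally; [ract m c] is m c. *)
Record bimodule (k : fieldType) (B C : algType k) := Bimodule {
  bimod_sort :> lmodType k;
  lact : B -> bimod_sort -> bimod_sort;
  ract : bimod_sort -> C -> bimod_sort;
  lact_linearl : forall m, linear (lact^~ m);
  lact_linearr : forall b, linear (lact b);
  ract_linearl : forall c, linear (ract^~ c);
  ract_linearr : forall m, linear (ract m);
  lact1 : forall m, lact 1 m = m;
  ract1 : forall m, ract m 1 = m;
  lactA : forall b b' m, lact (b * b') m = lact b (lact b' m);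
  ractA : forall m c c', ract m (c * c') = ract (ract m c) c';
  lractA : forall b m c, ract (lact b m) c = lact b (ract m c) }.

Record Qdata (k : fieldType) (Q : quiver) := QData {
  alg : vert Q -> algType k;
  bim : forall a : arr Q, bimodule (alg (tgt a)) (alg (src a));
  bim_neq0 : forall a, exists m : bim a, m != 0 }.

Section QsetDef.
Variables (k : fieldType) (Q : quiver) (X : Qdata k Q).

(* A (+) M, where A and M are the products of the A_x and of the M_a *)
Definition Lspace : Type := (dprod (alg X) * dprod (bim X))%type.
HB.instance Definition _ := GRing.Lmodule.on Lspace.

Definition inM (a : arr Q) (m : bim X a) : Lspace := (0, dinj m).

Definition lmulA (r : dprod (alg X)) (v : Lspace) : Lspace :=
  ((fun x => r x * v.1 x), (fun a => lact (r (tgt a)) (v.2 a))).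
Definition rmulA (v : Lspace) (r : dprod (alg X)) : Lspace :=
  ((fun x => v.1 x * r x), (fun a => ract (v.2 a) (r (src a)))).

(* v lies in the summand {}_yM_x of A (+) M (which is A_x if y = x, and 0 if
   y <> x and there is no arrow from x to y) *)
Definition in_hom (y x : vert Q) (v : Lspace) : Prop :=
  (forall z, v.1 z <> 0 -> z = x /\ z = y) /\
  (forall a, v.2 a <> 0 -> src a = x /\ tgt a = y).

(* The product of A (+) M determined by a family of maps M_b x M_a -> A (+) M *)
Definition Lmul (alpha : forall b a, bim X b -> bim X a -> Lspace)
    (u v : Lspace) : Lspace :=
  (((fun x => u.1 x * v.1 x),
    (fun a => lact (u.1 (tgt a)) (v.2 a) + ract (u.2 a) (v.1 (src a)))) : Lspace)
  + \sum_b \sum_a alpha b a (u.2 b) (v.2 a).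

End QsetDef.

(* [alpha b a] is the map alpha_{z,y,x} : {}_zM_y (x)_{A_y} {}_yM_x -> {}_zM_x
   for arrows a : x -> y and b : y -> z, presented as a k-bilinear A-balanced
   map M_b x M_a -> A (+) M with values in {}_zM_x; it is set to 0 when
   src b <> tgt a.  Elements of the A_x enter the axioms through families
   r : A = \prod_x A_x, the factor involved being selected by a vertex. *)
Record Qset (k : fieldType) (Q : quiver) := QSet {
  qdata :> Qdata k Q;
  alpha : forall b a, bim qdata b -> bim qdata a -> Lspace qdata;
  alpha_linearl : forall b a m, linear ((@alpha b a)^~ m);
  alpha_linearr : forall b a m, linear (@alpha b a m);
  alpha_hom : forall b a m' m,
    src b = tgt a -> in_hom (tgt b) (src a) (@alpha b a m' m);
  alpha_out : forall b a m' m, src b <> tgt a -> @alpha b a m' m = 0;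
  alpha_bal : forall b a m' m (r : dprod (alg qdata)), src b = tgt a ->
    @alpha b a (ract m' (r (src b))) m = @alpha b a m' (lact (r (tgt a)) m);
  alpha_lact : forall b a m' m (r : dprod (alg qdata)),
    @alpha b a (lact (r (tgt b)) m') m = lmulA r (@alpha b a m' m);
  alpha_ract : forall b a m' m (r : dprod (alg qdata)),
    @alpha b a m' (ract m (r (src a))) = rmulA (@alpha b a m' m) r;
  alpha_assoc : forall c b a (m'' : bim qdata c) (m' : bim qdata b) (m : bim qdata a),
    Lmul alpha (inM m'') (@alpha b a m' m) =
    Lmul alpha (@alpha c b m'' m') (inM m) }.

Definition zero_compositions (k : fieldType) (Q : quiver) (Delta : Qset k Q) : Prop :=
  forall (b a : arr Q) (m' : bim Delta b) (m : bim Delta a), alpha m' m = 0.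

Section Paths.
Variable Q : quiver.
Local Notation V0 := (vert Q).
Local Notation V1 := (arr Q).

(* (x, [:: a_m; ..; a_1]) encodes the path a_m ... a_1 with source x, and
   (x, [::]) the vertex x *)
Definition tgt_seq (x : V0) (l : seq V1) : V0 := if l is a :: _ then tgt a else x.

Fixpoint is_path (x : V0) (l : seq V1) : bool :=
  if l is a :: l' then (src a == tgt_seq x l') && is_path x l' else true.

Definition qpath : Type := {w : V0 * seq V1 | is_path w.1 w.2}.

Definition psrc (w : qpath) : V0 := (val w).1.
Definition parr (w : qpath) : seq V1 := (val w).2.
Definition ptgt (w : qpath) : V0 := tgt_seq (psrc w) (parr w).
Definition plen (w : qpath) : nat := size (parr w).

Definition is_cycle (w : qpath) : bool := psrc w == ptgt w.

(* w = w' w0 *)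
Definition is_concat (w' w0 w : qpath) : bool :=
  [&& psrc w' == ptgt w0, psrc w == psrc w0 & parr w == parr w' ++ parr w0].

(* paths of length at most n *)
Definition qpath_le n : Type := {w : V0 * n.-bseq V1 | is_path w.1 w.2}.
HB.instance Definition _ n := Finite.on (qpath_le n).
Definition to_qpath n (w : qpath_le n) : qpath :=
  exist (fun u : V0 * seq V1 => is_path u.1 u.2)
    ((val w).1, bseqval (val w).2) (valP w).

(* CQ_{<= n}, which contains the vertices, and DQ_{<= n} *)
Definition CQ n : Type := {w : qpath_le n | is_cycle (to_qpath w)}.
HB.instance Definition _ n := Finite.on (CQ n).
Definition DQ n : Type := {w : qpath_le n | ~~ is_cycle (to_qpath w)}.
HB.instance Definition _ n := Finite.on (DQ n).
Definition CQ_path n (g : CQ n) : qpath := to_qpath (val g).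
Definition DQ_path n (g : DQ n) : qpath := to_qpath (val g).

(* A trajectory is a sequence of vertices and arrows.  The one over
   a_m ... a_1 with waiting times p_{m+1}, .., p_1 is
   [traj_word x [:: a_m; ..; a_1] [:: p_{m+1}; ..; p_1]]. *)
Fixpoint traj_word (x : V0) (l : seq V1) (p : seq nat) : seq (V0 + V1) :=
  nseq (head 0%N p) (inl (tgt_seq x l))
  ++ (if l is a :: l' then inr a :: traj_word x l' (behead p) else [::]).

(* T_n(w), through waiting times *)
Definition trajs n (w : qpath) : {set (plen w).+1.-tuple 'I_n.+1} :=
  [set p : (plen w).+1.-tuple 'I_n.+1 | (plen w + \sum_i tnth p i == n)%N].
Definition wseq m n (p : m.-tuple 'I_n) : seq nat := [seq val i | i <- p].

End Paths.

Definition Lam (k : fieldType) (Q : quiver) (Delta : Qset k Q) : Type := Lspace Delta.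

Section LamRing.
Variables (k : fieldType) (Q : quiver) (Delta : Qset k Q).
Local Notation L := (Lam Delta).
Local Notation A := (dprod (alg Delta)).
Local Notation M := (dprod (bim Delta)).
Implicit Types (u v w : L) (r s : A) (m n : M).

HB.instance Definition _ := GRing.Lmodule.copy L (Lspace Delta).


Definition lam_mul : L -> L -> L := Lmul (@alpha k Q Delta).
Definition lam_one : L := ((fun=> 1), 0).
Local Notation mul := lam_mul.
Let inA (r : A) : L := (r, 0).

Fact lam_eqP u v : (forall x, u.1 x = v.1 x) -> (forall a, u.2 a = v.2 a) -> u = v.
Proof. by case: u v => [u1 u2] [v1 v2] /= e1 e2; congr (_, _); apply: dprodP. Qed.

Let lin0 (V W : lmodType k) (f : V -> W) : linear f -> f 0 = 0.
Proof. by move=> lf; have := lf (-1) 0 0; rewrite scaler0 addr0 scaleN1r addNr. Qed.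
Let linD (V W : lmodType k) (f : V -> W) : linear f -> {morph f : x y / x + y}.
Proof. by move=> lf x y; have := lf 1 x y; rewrite !scale1r. Qed.
Let linZ (V W : lmodType k) (f : V -> W) : linear f -> forall c x, f (c *: x) = c *: f x.
Proof. by move=> lf c x; have := lf c x 0; rewrite !addr0 (lin0 lf) addr0. Qed.
Let linS (V W : lmodType k) (f : V -> W) : linear f ->
  forall (I : finType) (F : I -> V), f (\sum_i F i) = \sum_i f (F i).
Proof.
by move=> lf I F; apply: (big_morph f (linD lf) (lin0 lf)).
Qed.

Fact lam_mul_linearl w : linear (mul^~ w).
Proof.
move=> c u v; rewrite /mul /Lmul scalerDr addrACA; congr (_ + _).
  apply: lam_eqP => [x|a] /=.
    by rewrite mulrDl -scalerAl.
  by rewrite (lact_linearl (w.2 a)) (ract_linearl (w.1 (src a))) scalerDr addrACA.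
rewrite scaler_sumr -big_split; apply: eq_bigr => b _ /=.
rewrite scaler_sumr -big_split; apply: eq_bigr => a _ /=.
exact: alpha_linearl.
Qed.

Fact lam_mul_linearr u : linear (mul u).
Proof.
move=> c v w; rewrite /mul /Lmul scalerDr addrACA; congr (_ + _).
  apply: lam_eqP => [x|a] /=.
    by rewrite mulrDr -scalerAr.
  by rewrite (lact_linearr (u.1 (tgt a))) (ract_linearr (u.2 a)) scalerDr addrACA.
rewrite scaler_sumr -big_split; apply: eq_bigr => b _ /=.
rewrite scaler_sumr -big_split; apply: eq_bigr => a _ /=.
exact: alpha_linearr.
Qed.

Let lmulA_linear r : linear (lmulA r : L -> L).
Proof.
move=> c u v; apply: lam_eqP => [x|a] /=; first by rewrite mulrDr -scalerAr.
exact: lact_linearr.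
Qed.
Let rmulA_linear r : linear ((rmulA (X := Delta))^~ r : L -> L).
Proof.
move=> c u v; apply: lam_eqP => [x|a] /=; first by rewrite mulrDl -scalerAl.
exact: ract_linearl.
Qed.

Let sum1E (J : finType) (F : J -> L) x : (\sum_j F j).1 x = \sum_j (F j).1 x.
Proof. by elim/big_rec2: _ => // j y z _ <-. Qed.
Let sum2E (J : finType) (F : J -> L) a : (\sum_j F j).2 a = \sum_j (F j).2 a.
Proof. by elim/big_rec2: _ => // j y z _ <-. Qed.

Let lmulA_mul r v w : lmulA r (mul v w) = mul (lmulA r v) w.
Proof.
rewrite /mul /Lmul (linD (lmulA_linear r)); congr (_ + _).
  apply: lam_eqP => [x|a] /=; first by rewrite mulrA.
  by rewrite (linD (lact_linearr _)) lactA lractA.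
rewrite (linS (lmulA_linear r)); apply: eq_bigr => b _.
rewrite (linS (lmulA_linear r)); apply: eq_bigr => a _ /=.
by rewrite alpha_lact.
Qed.

Let rmulA_mul r v w : rmulA (mul v w) r = mul v (rmulA w r).
Proof.
rewrite /mul /Lmul (linD (rmulA_linear r)); congr (_ + _).
  apply: lam_eqP => [x|a] /=; first by rewrite mulrA.
  by rewrite (linD (ract_linearl _)) ractA lractA.
rewrite (linS (rmulA_linear r)); apply: eq_bigr => b _.
rewrite (linS (rmulA_linear r)); apply: eq_bigr => a _ /=.
by rewrite alpha_ract.
Qed.

Let mul_mid r v w : mul (rmulA v r) w = mul v (lmulA r w).
Proof.
rewrite /mul /Lmul; congr (_ + _).
  by apply: lam_eqP => [x|a] /=; rewrite ?mulrA // lactA ractA.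
apply: eq_bigr => b _; apply: eq_bigr => a _ /=.
have [ba|/eqP ba] := eqVneq (src b) (tgt a); first exact: alpha_bal.
by rewrite !alpha_out.
Qed.

Let mulAl r v : mul (inA r) v = lmulA r v.
Proof.
rewrite /mul /Lmul [X in _ + X]big1 ?addr0; last first.
  by move=> b _; apply: big1 => a _; apply: (lin0 (alpha_linearl _)).
by apply: lam_eqP => [x|a] //=; rewrite (lin0 (ract_linearl _)) addr0.
Qed.

Let mulAr r v : mul v (inA r) = rmulA v r.
Proof.
rewrite /mul /Lmul [X in _ + X]big1 ?addr0; last first.
  by move=> b _; apply: big1 => a _; apply: (lin0 (alpha_linearr _)).
by apply: lam_eqP => [x|a] //=; rewrite (lin0 (lact_linearr _)) add0r.
Qed.

Let mulMM b a (m' : bim Delta b) (m : bim Delta a) : mul (inM m') (inM m) = alpha m' m.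
Proof.
rewrite /mul /Lmul (bigD1 b) //= (bigD1 a) //= /dinj !dfwith_in.
rewrite [X in alpha _ _ + X]big1 ?addr0; last first.
  by move=> c ne_ca; rewrite dfwith_out 1?eq_sym // (lin0 (alpha_linearr _)).
rewrite [X in _ + (_ + X)]big1 ?addr0; last first.
  move=> c ne_cb; apply: big1 => d _.
  by rewrite dfwith_out 1?eq_sym // (lin0 (alpha_linearl _)).
rewrite -[RHS]add0r; congr (_ + _); apply: lam_eqP => [x|c] /=; first by rewrite mulr0.
by rewrite (lin0 (lact_linearl _)) (lin0 (ract_linearr _)) addr0.
Qed.

Let decomp u : u = inA u.1 + \sum_a inM (u.2 a).
Proof.
apply: lam_eqP => [x|a].
  rewrite -[RHS]/(u.1 x + (\sum_a inM (u.2 a)).1 x) sum1E.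
  by rewrite big1 ?addr0.
rewrite -[RHS]/(0 + (\sum_b inM (u.2 b)).2 a) sum2E add0r.
by rewrite {1}(dinj_sum u.2) dprod_sumE.
Qed.

Fact lam_mulDl : left_distributive mul +%R.
Proof. by move=> u v w; apply: (linD (lam_mul_linearl w)). Qed.

Fact lam_mulDr : right_distributive mul +%R.
Proof. by move=> u v w; apply: (linD (lam_mul_linearr u)). Qed.

Let mulSl (J : finType) (F : J -> L) w : mul (\sum_j F j) w = \sum_j mul (F j) w.
Proof. exact: (linS (lam_mul_linearl w)). Qed.
Let mulSr (J : finType) (F : J -> L) w : mul w (\sum_j F j) = \sum_j mul w (F j).
Proof. exact: (linS (lam_mul_linearr w)). Qed.

Let mulMMM c b a (m'' : bim Delta c) (m' : bim Delta b) (m : bim Delta a) :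
  mul (inM m'') (mul (inM m') (inM m)) = mul (mul (inM m'') (inM m')) (inM m).
Proof. by rewrite !mulMM; apply: alpha_assoc. Qed.

Fact lam_mulA : associative mul.
Proof.
move: lam_mulDl lam_mulDr mulSl mulSr mulAl mulAr lmulA_mul rmulA_mul mul_mid mulMMM.
move: lam_mul => f fDl fDr fSl fSr fAl fAr fl fr fm fMMM u v w.
rewrite (decomp u) !fDl !fAl fl; congr (_ + _); rewrite !fSl; apply: eq_bigr => c _.
rewrite (decomp w) !fDr !fAr fr; congr (_ + _); rewrite !fSr; apply: eq_bigr => a _.
rewrite (decomp v) !(fDl, fDr) fAl fAr fm; congr (_ + _).
by rewrite !(fSl, fSr); apply: eq_bigr => b _.
Qed.

Fact lam_mul1 : left_id lam_one mul.
Proof.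
move=> u; rewrite -[lam_one]/(inA _) mulAl.
by apply: lam_eqP => [x|a] /=; rewrite ?mul1r ?lact1.
Qed.

Fact lam_mulr1 : right_id lam_one mul.
Proof.
move=> u; rewrite -[lam_one]/(inA _) mulAr.
by apply: lam_eqP => [x|a] /=; rewrite ?mulr1 ?ract1.
Qed.

(* pzRingType rather than algType: nothing forces vert Q to be inhabited. *)
HB.instance Definition _ := GRing.Zmodule_isPzRing.Build L
  lam_mulA lam_mul1 lam_mulr1 lam_mulDl lam_mulDr.

Lemma lam_scalerAl (c : k) u v : c *: (u * v) = (c *: u) * v.
Proof. exact: esym (linZ (lam_mul_linearl v) c u). Qed.

Lemma lam_scalerAr (c : k) u v : c *: (u * v) = u * (c *: v).
Proof. exact: esym (linZ (lam_mul_linearr u) c v). Qed.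

(* the unit e_x of A_x *)
Definition vunit (x : vert Q) : L := (dinj (1 : alg Delta x), 0).

(* D = \prod_x k e_x *)
Definition inD (d : L) : Prop := exists c : vert Q -> k, d = \sum_x c x *: vunit x.

End LamRing.

Section Hochschild.
Variables (k : fieldType) (Q : quiver) (Delta : Qset k Q).
Local Notation L := (Lam Delta).

Definition cochain (n : nat) : Type := ('I_n -> L) -> L.
HB.instance Definition _ n := GRing.Lmodule.on (cochain n).

Definition upd n (v : 'I_n -> L) (i : 'I_n) (x : L) : 'I_n -> L :=
  fun j => if j == i then x else v j.

(* Hom_{D-D} (Lambda^{(x)_D n}, Lambda), through the universal property of the
   tensor power; for n = 0 the last condition says that the value of f
   centralizes D. *)
Definition Jpred n (f : cochain n) : Prop :=
  [/\ forall v i, linear (fun x => f (upd v i x)),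
      forall v (i j : 'I_n) d, inD d -> j = i.+1 :> nat ->
        f (upd v i (v i * d)) = f (upd v j (d * v j)),
      forall v (i : 'I_n) d, inD d -> i = 0%N :> nat ->
        f (upd v i (d * v i)) = d * f v,
      forall v (i : 'I_n) d, inD d -> i.+1 = n ->
        f (upd v i (v i * d)) = f v * d &
      forall v d, inD d -> n = 0%N -> d * f v = f v * d].

(* v_0, .., v_i v_(i+1), .., v_n *)
Definition merge n (i : 'I_n) (v : 'I_n.+1 -> L) : 'I_n -> L := fun j =>
  if (j < i)%N then v (widen_ord (leqnSn n) j)
  else if j == i then v (widen_ord (leqnSn n) j) * v (lift ord0 j)
  else v (lift ord0 j).

Definition hochd n (f : cochain n) : cochain n.+1 := fun v =>
  v ord0 * f (fun j => v (lift ord0 j))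
  + \sum_(i < n) (-1) ^+ i.+1 *: f (merge i v)
  + (-1) ^+ n.+1 *: (f (fun j => v (widen_ord (leqnSn n) j)) * v ord_max).

Fact Jpred_0 n : Jpred (0 : cochain n).
Proof.
split=> // [v i c x y|v i d _ _|v i d _ _|v d _ _].
- by rewrite /= scaler0 addr0.
- by rewrite /= mulr0.
- by rewrite /= mul0r.
- by rewrite /= mulr0 mul0r.
Qed.

Fact Jpred_lin n c (f g : cochain n) : Jpred f -> Jpred g -> Jpred (c *: f + g).
Proof.
move=> [f1 f2 f3 f4 f5] [g1 g2 g3 g4 g5]; split=> [v i b x y|v i j d Dd ij|v i d Dd i0|v i d Dd i0|v d Dd n0].
- rewrite -[LHS]/(c *: f _ + g _) (f1 v i) (g1 v i).
  by rewrite /= !scalerDr addrACA scalerA (mulrC c) -scalerA.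
- rewrite -[LHS]/(c *: f _ + g _) -[RHS]/(c *: f _ + g _).
  by rewrite (f2 v i j d) // (g2 v i j d).
- rewrite -[LHS]/(c *: f _ + g _) -[RHS]/(d * (c *: f _ + g _)).
  by rewrite f3 // g3 // mulrDr lam_scalerAr.
- rewrite -[LHS]/(c *: f _ + g _) -[RHS]/((c *: f _ + g _) * d).
  by rewrite f4 // g4 // mulrDl lam_scalerAl.
- rewrite -[LHS]/(d * (c *: f _ + g _)) -[RHS]/((c *: f _ + g _) * d).
  by rewrite mulrDl mulrDr -lam_scalerAl -lam_scalerAr f5 // g5.
Qed.

Definition Jsp n : subspace (cochain n) := Subspace (@Jpred_0 n) (@Jpred_lin n).

Fact hochd_linear n : linear (@hochd n).
Proof.
move=> c f g; apply: funext => v.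
have E n' (f' g' : cochain n') x : (c *: f' + g') x = c *: f' x + g' x by [].
rewrite E /hochd !E mulrDr mulrDl -lam_scalerAr -lam_scalerAl.
under eq_bigr do rewrite E scalerDr scalerA mulrC -scalerA.
rewrite big_split -scaler_sumr /= [(-1) ^+ n.+1 *: (_ + _)]scalerDr scalerA [_ * c]mulrC -scalerA.
rewrite [c *: (_ + _ + _)]scalerDr [c *: (_ + _)]scalerDr [RHS]addrACA.
by congr (_ + _); apply: addrACA.
Qed.
HB.instance Definition _ n := GRing.isLinear.Build k (cochain n) (cochain n.+1) *:%R (@hochd n) (@hochd_linear n).

Definition cup n' n (f' : cochain n') (f : cochain n) : cochain (n' + n) := fun v =>
  f' (fun i => v (lshift n i)) * f (fun i => v (rshift n' i)).

End Hochschild.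

Section Complexes.
Variables (k : fieldType) (Q : quiver) (Delta : Qset k Q).
Local Notation L := (Lam Delta).
Local Notation cochain := (cochain Delta).

(* the projection of Lambda_Delta onto its summand A_x or M_a *)
Definition lcomp (c : vert Q + arr Q) (v : L) : L :=
  match c with
  | inl x => (dinj (v.1 x), 0)
  | inr a => (0, dinj (v.2 a))
  end.

(* Let tau be the trajectory over w with waiting times p.  The component of
   f : J^n in Hom_k(tau_Delta, Delta_w) is identified with its extension by zero
   to Lambda^{(x)_D n}, tau_Delta and Delta_w = e_{t(w)} Lambda e_{s(w)} being
   direct summands of Lambda^{(x)_D n} and of Lambda.  (For n = 0 the word is
   empty, and only the idempotents depend on w.) *)
Definition tcomp n (w : qpath Q) (p : seq nat) (f : cochain n) : cochain n := fun v =>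
  vunit Delta (ptgt w)
  * f (fun i => lcomp (nth (inl (psrc w)) (traj_word (psrc w) (parr w) p) i) (v i))
  * vunit Delta (psrc w).

Definition pcomp n (w : qpath Q) (f : cochain n) : cochain n :=
  \sum_(p in trajs n w) tcomp w (wseq p) f.

(* f |-> \sum_(tau in T_n(w)) \sum_(sigma in tau_0^+) (d f_tau)_sigma *)
Definition Kd (w : qpath Q) n (f : cochain n) : cochain n.+1 :=
  \sum_(p in trajs n w) \sum_(i < (plen w).+1)
    tcomp w (incr_nth (wseq p) i) (hochd (tcomp w (wseq p) f)).

Fact tcomp_linear n w p : linear (@tcomp n w p).
Proof.
move=> c f g; apply: funext => v.
rewrite -[RHS]/(c *: tcomp w p f v + tcomp w p g v) /tcomp.
by rewrite lam_scalerAl lam_scalerAr -mulrDl -mulrDr.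
Qed.
HB.instance Definition _ n w p := GRing.isLinear.Build k (cochain n) (cochain n) *:%R
  (@tcomp n w p) (@tcomp_linear n w p).

Fact pcomp_linear n w : linear (@pcomp n w).
Proof.
move=> c f g; rewrite /pcomp scaler_sumr -big_split; apply: eq_bigr => p _.
by rewrite linearP.
Qed.
HB.instance Definition _ n w := GRing.isLinear.Build k (cochain n) (cochain n) *:%R
  (@pcomp n w) (@pcomp_linear n w).

Fact Kd_linear w n : linear (@Kd w n).
Proof.
move=> c f g; rewrite /Kd scaler_sumr -big_split; apply: eq_bigr => p _.
rewrite scaler_sumr -big_split; apply: eq_bigr => i _.
by rewrite !linearP.
Qed.
HB.instance Definition _ w n := GRing.isLinear.Build k (cochain n) (cochain n.+1) *:%R
  (@Kd w n) (@Kd_linear w n).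

(* J^n_w, the degree n part of K_w *)
Definition Kpred (w : qpath Q) n (f : cochain n) : Prop := Jpred f /\ f = pcomp w f.

(* D^n; the sum over all of DQ reduces to length at most n since T_n(w) is
   empty when w is longer. *)
Definition Dpred n (f : cochain n) : Prop :=
  Jpred f /\ f = \sum_(w : DQ Q n) pcomp (DQ_path w) f.

Fact Kpred_0 w n : Kpred w (0 : cochain n).
Proof. by split; [apply: Jpred_0 | rewrite linear0]. Qed.
Fact Kpred_lin w n c (f g : cochain n) : Kpred w f -> Kpred w g -> Kpred w (c *: f + g).
Proof.
move=> [Jf ef] [Jg eg]; split; first exact: Jpred_lin.
by rewrite linearP {1}ef {1}eg.
Qed.
Definition Ksp w n : subspace (cochain n) := Subspace (@Kpred_0 w n) (@Kpred_lin w n).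

Fact Dpred_0 n : Dpred (0 : cochain n).
Proof.
by split; [apply: Jpred_0 | rewrite big1 // => w _; rewrite linear0].
Qed.
Fact Dpred_lin n c (f g : cochain n) : Dpred f -> Dpred g -> Dpred (c *: f + g).
Proof.
move=> [Jf ef] [Jg eg]; split; first exact: Jpred_lin.
rewrite {1}ef {1}eg scaler_sumr -big_split; apply: eq_bigr => w _.
by rewrite linearP.
Qed.
Definition Dsp n : subspace (cochain n) := Subspace (@Dpred_0 n) (@Dpred_lin n).

Definition zsp n : subspace (cochain n) := zero_subspace (cochain n).

End Complexes.

Section CohomologyMaps.
Variables (k : fieldType) (Q : quiver) (Delta : Qset k Q).
Local Notation V := (cochain Delta).

Definition hochd_lin n : {linear V n -> V n.+1} := @hochd k Q Delta n.
Definition Kd_lin (w : qpath Q) n : {linear V n -> V n.+1} := @Kd k Q Delta w n.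

(* HH^n(Lambda_Delta) is computed by the complex J relative to the separable
   subalgebra D. *)
Definition HH n : lmodType k := cohom hochd_lin (Jsp Delta) (zsp Delta) n.
Definition HD n : lmodType k := cohom hochd_lin (Dsp Delta) (zsp Delta) n.
Definition HJD n : lmodType k := cohom hochd_lin (Jsp Delta) (Dsp Delta) n.
Definition Hpath (w : qpath Q) n : lmodType k := cohom (Kd_lin w) (Ksp Delta w) (zsp Delta) n.

Definition sumDQ n : lmodType k := dprod (fun w : DQ Q n => Hpath (DQ_path w) n).
(* Equivalently HH^n(A) (+) \bigoplus_(g in CQ_{<= n}, g not a vertex) H^n_g, as
   H^n_x = HH^n(A_x) for a vertex x. *)
Definition sumCQ n : lmodType k := dprod (fun g : CQ Q n => Hpath (CQ_path g) n).

(* With zero compositions, D is the direct sum of the complexes K_w over the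
   non cycles w, which identifies sumDQ with H(D); and J/D is the direct sum of
   the K_g over the cycles g, which identifies H(J/D) with sumCQ.  The arguments
   of [hclass] below are then cocycles. *)
Definition sumDQ_to_HD n (h : sumDQ n) : HD n :=
  hclass hochd_lin (Dsp Delta) (zsp Delta) (\sum_(w : DQ Q n) hrep (h w)).
Definition HD_to_HH n (h : HD n) : HH n :=
  hclass hochd_lin (Jsp Delta) (zsp Delta) (hrep h).
Definition HH_to_HJD n (h : HH n) : HJD n :=
  hclass hochd_lin (Jsp Delta) (Dsp Delta) (hrep h).
Definition HJD_to_sumCQ n (h : HJD n) : sumCQ n := fun g =>
  hclass (Kd_lin (CQ_path g)) (Ksp Delta (CQ_path g)) (zsp Delta) (pcomp (CQ_path g) (hrep h)).

Definition iota_map n (h : sumDQ n) : HH n := HD_to_HH (sumDQ_to_HD h).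
Definition pi_map n (h : HH n) : sumCQ n := HJD_to_sumCQ (HH_to_HJD h).

Definition HHone : HH 0 :=
  hclass hochd_lin (Jsp Delta) (zsp Delta) ((fun=> 1) : V 0).
Definition HHcup n' n (h' : HH n') (h : HH n) : HH (n' + n) :=
  hclass hochd_lin (Jsp Delta) (zsp Delta) (cup (hrep h') (hrep h)).

(* The cup product H^{n'}_{w'} x H^n_{w0} -> H^{n'+n}_w for w = w' w0.  Cochains
   along paths being extended by zero, it is computed by [cup]. *)
Definition path_cup (w' w0 w : qpath Q) n' n (h' : Hpath w' n') (h : Hpath w0 n) :
    Hpath w (n' + n) :=
  if is_concat w' w0 w
  then hclass (Kd_lin w) (Ksp Delta w) (zsp Delta) (cup (hrep h') (hrep h))
  else 0.

Definition sumCQ_one : sumCQ 0 := fun g =>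
  hclass (Kd_lin (CQ_path g)) (Ksp Delta (CQ_path g)) (zsp Delta)
    ((fun=> vunit Delta (psrc (CQ_path g))) : V 0).
Definition sumCQ_cup n' n (h' : sumCQ n') (h : sumCQ n) : sumCQ (n' + n) := fun g =>
  \sum_(g' : CQ Q n') \sum_(g0 : CQ Q n) path_cup (CQ_path g) (h' g') (h g0).

End CohomologyMaps.

(* Main.v *)
Require Import Defs.
From mathcomp Require Import all_boot all_algebra.
From mathcomp Require Import boolp zify.
Set Implicit Arguments.
Unset Strict Implicit.
Unset Printing Implicit Defensive.
Import GRing.Theory.
Local Open Scope ring_scope.

(** Everything rests on M * M = 0 and on the absence of loops.

    A cochain over a non cycle w takes its values in e_t Lambda e_s with
    t <> s, hence in M, because A is diagonal.  So the product of two values of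
    cochains in D^n vanishes ([cup_Dpred]), already before passing to
    cohomology.  The statement on the images of iota then only needs the cup
    product of classes to be computed on arbitrary representatives; this
    follows from the Leibniz rule ([hochd_cup], [hclass_cup]).

    For pi, the point is that over a cycle w the Hochschild coboundary restricts
    to the coboundary along w: the component of d f over w is the differential
    of f in K_w ([Kd_hochd]).  Evaluate d f on the word of a trajectory sigma
    over w.  A term of d f that merges two letters either deletes a vertex
    letter, which is the passage from sigma to a trajectory tau with
    sigma in tau_0^+, or multiplies two arrows and vanishes.  In the first and
    last terms an outer letter multiplies a value of f.  If the letter is a
    vertex, it is again deleted.  If it is an arrow a, say the first letter, the
    value of f lies in e_(s(a)) Lambda e_(s(w)), and s(w) = t(w) = t(a) differs
    from s(a), so that this value is in M and the product vanishes.  Hence taking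
    the component over w maps J to K_w as a complex and kills D, which gives a
    description of pi on representatives ([pi_hclass]) and its linearity.

    For multiplicativity, the word of a trajectory of duration n' + n over a
    cycle g is cut after n' letters.  The two halves run over paths w' and w0
    with g = w' w0.  If w0 is a cycle, so is w', and the pair gives one term of
    the cup product along paths.  Otherwise neither is a cycle, both values lie
    in M, and their product is zero ([ev_pcomp_cup]).  The cup product along
    paths is well defined on classes by the Leibniz rule in K_w ([Kd_cup]),
    which comes from the one in J by [Kd_hochd]. *)

(** * Classes in the cohomology of a quotient complex *)

Lemma linear_fun0 (k : fieldType) (V W : lmodType k) (f : V -> W) : linear f -> f 0 = 0.
Proof. by move=> lf; have := lf (-1) 0 0; rewrite scaler0 addr0 scaleN1r addNr. Qed.

Lemma subspaceZ (k : fieldType) (V : lmodType k) (S : subspace V) c v : S v -> S (c *: v).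
Proof. by move=> Sv; rewrite -[_ *: _]addr0; apply: subspace_lin => //; apply: subspace_0. Qed.

Lemma subspaceD (k : fieldType) (V : lmodType k) (S : subspace V) u v : S u -> S v -> S (u + v).
Proof. by move=> Su Sv; rewrite -[u]scale1r; apply: subspace_lin. Qed.

Section Classes.
Variables (k : fieldType) (V : nat -> lmodType k).
Variables (d : forall n, {linear V n -> V n.+1}) (P R : forall n, subspace (V n)).

Local Notation hcl := (hclass d P R).

Lemma hclass_linear n c (f g : V n) : cocycle d P R f -> cocycle d P R g ->
  hcl (c *: f + g) = c *: hcl f + hcl g.
Proof.
move=> Zf Zg; have Zfg : cocycle d P R (c *: f + g) by apply: (cocycle_lin (d := d)).
rewrite /hclass -[RHS]/(subquo_scale c _ + _) -subquo_piZ -subquo_piD; congr subquo_pi.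
by apply: val_inj; rewrite linearP /= !insubdK //; apply/asboolP.
Qed.

Lemma hclass0 n : hcl (0 : V n) = 0.
Proof.
have Z0 : cocycle d P R (0 : V n) by apply: cocycle_0.
by have := hclass_linear (-1) Z0 Z0; rewrite scaler0 addr0 scaleN1r addNr.
Qed.

Lemma cocycle_sum n (I : finType) (S : pred I) (F : I -> V n) :
  (forall i, S i -> cocycle d P R (F i)) -> cocycle d P R (\sum_(i | S i) F i).
Proof.
move=> ZF; apply: (big_ind (fun f : V n => cocycle d P R f)) => // [|u v Zu Zv].
  exact: cocycle_0.
by rewrite -[u]scale1r; apply: (cocycle_lin (d := d)).
Qed.

Lemma hclass_sum n (I : finType) (S : pred I) (F : I -> V n) :
  (forall i, S i -> cocycle d P R (F i)) ->
  hcl (\sum_(i | S i) F i) = \sum_(i | S i) hcl (F i).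
Proof.
move=> ZF.
suff [] : cocycle d P R (\sum_(i | S i) F i) /\
  hcl (\sum_(i | S i) F i) = \sum_(i | S i) hcl (F i) by [].
apply: (big_ind2 (fun u c => cocycle d P R u /\ hcl u = c)) => [|u c v e [Zu <-] [Zv <-]|i Si].
- by split; [apply: cocycle_0 | apply: hclass0].
- rewrite -[u]scale1r; split; last by rewrite hclass_linear // !scale1r.
  exact: (cocycle_lin (d := d)).
- by split=> //; apply: ZF.
Qed.

Lemma hrep_hclass n (f : V n) : cocycle d P R f -> coboundary d P R (hrep (hcl f) - f).
Proof. by move=> Zf; apply/hclassP=> //; [apply: hrep_cocycle | apply: hrepK]. Qed.

End Classes.

(** * The algebra of a Q-set *)
Section Algebra.
Variables (k : fieldType) (Q : quiver) (Delta : Qset k Q).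
Local Notation L := (Lam Delta).
Local Notation e := (vunit Delta).
Local Notation letter := (vert Q + arr Q)%type.
Implicit Types (u v d : L) (x y : vert Q) (a b : arr Q).

Definition lsrc (c : letter) : vert Q := match c with inl x => x | inr a => src a end.
Definition ltgt (c : letter) : vert Q := match c with inl x => x | inr a => tgt a end.

(** Taking the element of V i from a family avoids a transport along i = j. *)
Lemma dinj_comp (I : finType) (V : I -> lmodType k) (f : forall i, V i) (i j : I) :
  dinj (f i) j = if i == j then f j else 0.
Proof.
rewrite /dinj; case: eqVneq => [eij|ne_ij]; last by rewrite dfwith_out.
by case: j / eij; rewrite dfwith_in.
Qed.

Lemma vunit1E x y : (e x).1 y = (x == y)%:R.
Proof. by rewrite -[LHS]/(dinj ((fun z => 1 : alg Delta z) x) y) dinj_comp; case: eqP. Qed.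

Lemma lcomp1E c v x : (lcomp c v).1 x = if c == inl x then v.1 x else 0.
Proof. by case: c => [y|a] //=; rewrite dinj_comp. Qed.
Lemma lcomp2E c v a : (lcomp c v).2 a = if c == inr a then v.2 a else 0.
Proof. by case: c => [y|b] //=; rewrite dinj_comp. Qed.

Lemma sum_fstE (I : Type) (r : seq I) (P : pred I) (F : I -> L) x :
  (\sum_(i <- r | P i) F i).1 x = \sum_(i <- r | P i) (F i).1 x.
Proof. by elim/big_rec2: _ => // i v s _ <-. Qed.

Lemma sum_sndE (I : Type) (r : seq I) (P : pred I) (F : I -> L) a :
  (\sum_(i <- r | P i) F i).2 a = \sum_(i <- r | P i) (F i).2 a.
Proof. by elim/big_rec2: _ => // i v s _ <-. Qed.

Lemma lam_sign (v : L) m : (-1) ^+ m *: v = (-1) ^+ m * v.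
Proof.
elim: m => [|m IH]; first by rewrite scale1r mul1r.
by rewrite !exprS !mulN1r scaleNr mulNr IH.
Qed.

(** The alpha terms are assumed to vanish only on the given factors: this covers
    products with an element of A for arbitrary alpha, and all products when
    there are zero compositions. *)
Lemma lam_mul1E u v x : (forall b a, alpha (u.2 b) (v.2 a) = 0) ->
  (u * v).1 x = u.1 x * v.1 x.
Proof.
move=> uv0; rewrite -[u * v]/(Lmul _ u v) /Lmul big1 ?addr0 // => b _.
by apply: big1 => a _; apply: uv0.
Qed.

Lemma lam_mul2E u v a : (forall b a, alpha (u.2 b) (v.2 a) = 0) ->
  (u * v).2 a = lact (u.1 (tgt a)) (v.2 a) + ract (u.2 a) (v.1 (src a)).
Proof.
move=> uv0; rewrite -[u * v]/(Lmul _ u v) /Lmul big1 ?addr0 // => b _.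
by apply: big1 => c _; apply: uv0.
Qed.

Lemma lact0l a (m : bim Delta a) : lact 0 m = 0.
Proof. exact: (linear_fun0 (lact_linearl m)). Qed.
Lemma lact0r a r : lact r (0 : bim Delta a) = 0.
Proof. exact: (linear_fun0 (lact_linearr r)). Qed.
Lemma ract0l a r : ract (0 : bim Delta a) r = 0.
Proof. exact: (linear_fun0 (ract_linearl r)). Qed.
Lemma ract0r a (m : bim Delta a) : ract m 0 = 0.
Proof. exact: (linear_fun0 (ract_linearr m)). Qed.

Lemma alpha0l b a (m : bim Delta a) : alpha (0 : bim Delta b) m = 0.
Proof. exact: (linear_fun0 (alpha_linearl m)). Qed.
Lemma alpha0r b a (m : bim Delta b) : alpha m (0 : bim Delta a) = 0.
Proof. exact: (linear_fun0 (alpha_linearr m)). Qed.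

(** The element of D with coordinates c in the basis of the e_x. *)
Definition diag (c : vert Q -> k) : L := ((fun x => (c x)%:A), 0).

Lemma diagl1 (c : vert Q -> k) v x : (diag c * v).1 x = c x *: v.1 x.
Proof. by rewrite lam_mul1E => [|b a]; rewrite /= ?alpha0l // -scalerAl mul1r. Qed.
Lemma diagr1 (c : vert Q -> k) v x : (v * diag c).1 x = c x *: v.1 x.
Proof. by rewrite lam_mul1E => [|b a]; rewrite /= ?alpha0r // -scalerAr mulr1. Qed.
Lemma diagl2 (c : vert Q -> k) v a : (diag c * v).2 a = c (tgt a) *: v.2 a.
Proof.
rewrite lam_mul2E => [|b a']; rewrite /= ?alpha0l // ract0l addr0.
have := lact_linearl (v.2 a) (c (tgt a)) 1 0.
by rewrite !addr0 lact0l addr0 lact1.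
Qed.
Lemma diagr2 (c : vert Q -> k) v a : (v * diag c).2 a = c (src a) *: v.2 a.
Proof.
rewrite lam_mul2E => [|b a']; rewrite /= ?alpha0r // lact0r add0r.
have := ract_linearr (v.2 a) (c (src a)) 1 0.
by rewrite !addr0 ract0r addr0 ract1.
Qed.

Definition diagE := (diagl1, diagr1, diagl2, diagr2).

Lemma vunitE x : e x = diag (fun y => (x == y)%:R).
Proof. by apply: lam_eqP => // y; rewrite vunit1E /=; case: eqP; rewrite ?scale1r ?scale0r. Qed.

Lemma one_diag : 1 = diag (fun=> 1).
Proof. by apply: lam_eqP => //= x; rewrite scale1r. Qed.

Lemma inDP d : inD d <-> exists c, d = diag c.
Proof.
have E (c : vert Q -> k) : \sum_x c x *: e x = diag c.
  apply: lam_eqP => [y|a].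
    rewrite sum_fstE (bigD1 y) //= big1 ?addr0.
      by rewrite -[LHS]/(c y *: (e y).1 y) vunit1E eqxx.
    move=> x xy; rewrite -[LHS]/(c x *: (e x).1 y) vunit1E.
    by rewrite (negbTE xy) scaler0.
  by rewrite sum_sndE big1 // => x _; rewrite -[LHS]/(c x *: 0) scaler0.
by split=> [[c ->]|[c ->]]; exists c.
Qed.

Lemma inD_vunit x : inD (e x).
Proof. by apply/inDP; eexists; apply: vunitE. Qed.

Lemma inD1 : inD (1 : L).
Proof. by apply/inDP; eexists; apply: one_diag. Qed.

Lemma inD_comm d d' : inD d -> inD d' -> d * d' = d' * d.
Proof.
move=> /inDP[c ->] /inDP[c' ->]; apply: lam_eqP => [x|a].
  by rewrite !diagl1 /= !scalerA mulrC.
by rewrite !diagl2 !scaler0.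
Qed.

Lemma inDM d d' : inD d -> inD d' -> inD (d * d').
Proof.
move=> /inDP[c ->] /inDP[c' ->]; apply/inDP; exists (fun x => c x * c' x).
by apply: lam_eqP => [x|a]; rewrite ?diagl1 ?diagl2 /= ?scalerA // scaler0.
Qed.

Lemma vunitM x y : e x * e y = if x == y then e x else 0.
Proof.
apply: lam_eqP => [z|a]; rewrite [X in X * _]vunitE ?diagl1 ?diagl2; last first.
  by rewrite scaler0; case: eqP.
rewrite vunit1E; case: (eqVneq x y) => [<-|ne_xy]; rewrite ?vunit1E.
  by case: eqP; rewrite ?scale1r ?scale0r.
case: eqP => [<-|_]; last by rewrite scale0r.
by rewrite eq_sym (negbTE ne_xy) scaler0.
Qed.

Lemma vunitK x : e x * e x = e x.
Proof. by rewrite vunitM eqxx. Qed.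

Lemma vunitKA x v : e x * (e x * v) = e x * v.
Proof. by rewrite mulrA vunitK. Qed.

Lemma lcomp_linear c : linear (lcomp c : L -> L).
Proof.
move=> r u v; apply: lam_eqP => [x|a].
  rewrite -[RHS]/(r *: (lcomp c u).1 x + (lcomp c v).1 x) !lcomp1E.
  by case: ifP; rewrite ?scaler0 ?addr0.
rewrite -[RHS]/(r *: (lcomp c u).2 a + (lcomp c v).2 a) !lcomp2E.
by case: ifP; rewrite ?scaler0 ?addr0.
Qed.

Lemma lcomp_inDl c d v : inD d -> lcomp c (d * v) = d * lcomp c v.
Proof.
move=> /inDP[r ->]; apply: lam_eqP => [x|a]; rewrite ?lcomp1E ?lcomp2E !diagE.
  by rewrite lcomp1E; case: ifP; rewrite ?scaler0.
by rewrite lcomp2E; case: ifP; rewrite ?scaler0.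
Qed.

Lemma lcomp_inDr c d v : inD d -> lcomp c (v * d) = lcomp c v * d.
Proof.
move=> /inDP[r ->]; apply: lam_eqP => [x|a]; rewrite ?lcomp1E ?lcomp2E !diagE.
  by rewrite lcomp1E; case: ifP; rewrite ?scaler0.
by rewrite lcomp2E; case: ifP; rewrite ?scaler0.
Qed.

Lemma lcomp_tgt c v : e (ltgt c) * lcomp c v = lcomp c v.
Proof.
rewrite vunitE; apply: lam_eqP => [x|a]; rewrite !diagE ?lcomp1E ?lcomp2E.
  by case: (c =P inl x) => [->|] /=; rewrite ?scaler0 // eqxx scale1r.
by case: (c =P inr a) => [->|] /=; rewrite ?scaler0 // eqxx scale1r.
Qed.

Lemma lcomp_src c v : lcomp c v * e (lsrc c) = lcomp c v.
Proof.
rewrite vunitE; apply: lam_eqP => [x|a]; rewrite !diagE ?lcomp1E ?lcomp2E.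
  by case: (c =P inl x) => [->|] /=; rewrite ?scaler0 // eqxx scale1r.
by case: (c =P inr a) => [->|] /=; rewrite ?scaler0 // eqxx scale1r.
Qed.

Lemma lcomp_lcomp c c' v : lcomp c (lcomp c' v) = if c == c' then lcomp c v else 0.
Proof.
apply: lam_eqP => [x|a]; rewrite !(lcomp1E, lcomp2E).
  case: (c =P inl x) => [->|ne_cx]; last by case: ifP => // _; rewrite lcomp1E; case: eqP.
  by rewrite [c' == _]eq_sym; case: ifP; rewrite // lcomp1E eqxx.
case: (c =P inr a) => [->|ne_ca]; last by case: ifP => // _; rewrite lcomp2E; case: eqP.
by rewrite [c' == _]eq_sym; case: ifP; rewrite // lcomp2E eqxx.
Qed.

(** A is diagonal, so that for x <> y only M contributes to e_x Lambda e_y. *)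
Lemma peirce_off_diag x y u z : x != y -> (e x * u * e y).1 z = 0.
Proof.
move=> ne_xy; rewrite !vunitE !diagE; case: (eqVneq y z) => [<-|_]; last by rewrite scale0r.
by rewrite (negbTE ne_xy) scale0r scaler0.
Qed.

(** A_x acts on each summand of Lambda (by zero, unless x is its target), so
    merging a vertex letter with the next letter c leaves a word with letter c. *)
Lemma lcomp_mulV x c u v :
  lcomp c (lcomp (inl x) u * lcomp c v) = lcomp (inl x) u * lcomp c v.
Proof.
have z b a : alpha ((lcomp (inl x) u : L).2 b) ((lcomp c v : L).2 a) = 0 by apply: alpha0l.
apply: lam_eqP => [y|a].
  rewrite [LHS]lcomp1E (lam_mul1E _ z) (lcomp1E c).
  by case: (c == inl y); rewrite ?mulr0.
rewrite [LHS]lcomp2E (lam_mul2E _ z) (lcomp2E c) (lcomp2E (inl x)) ract0l addr0.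
by case: (c == inr a); rewrite ?lact0r.
Qed.

Lemma lcomp_mulVr x c u v :
  lcomp c (lcomp c u * lcomp (inl x) v) = lcomp c u * lcomp (inl x) v.
Proof.
have z b a : alpha ((lcomp c u : L).2 b) ((lcomp (inl x) v : L).2 a) = 0 by apply: alpha0r.
apply: lam_eqP => [y|a].
  rewrite [LHS]lcomp1E (lam_mul1E _ z) (lcomp1E c).
  by case: (c == inl y); rewrite ?mul0r.
rewrite [LHS]lcomp2E (lam_mul2E _ z) (lcomp2E c) (lcomp2E (inl x)) lact0r add0r.
by case: (c == inr a); rewrite ?ract0l.
Qed.

Hypothesis zeroDelta : zero_compositions Delta.

(** M * M = 0: the only use of the hypothesis on the composition maps. *)
Lemma mul_inM0 u v : (forall x, u.1 x = 0) -> (forall x, v.1 x = 0) -> u * v = 0.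
Proof.
move=> u0 v0; have z b a : alpha (u.2 b) (v.2 a) = 0 by apply: zeroDelta.
apply: lam_eqP => [x|a]; rewrite ?lam_mul1E ?lam_mul2E // !(u0, v0) ?mul0r //.
by rewrite lact0l ract0r addr0.
Qed.

End Algebra.


(** * Words and trajectories *)
Section Words.
Variable Q : quiver.
Local Notation letter := (vert Q + arr Q)%type.
Implicit Types (x y : vert Q) (a b : arr Q) (u : seq letter) (l : seq (arr Q)) (p : seq nat).

(** The target of a word of source x; the empty word is a vertex. *)
Definition wtgt x u : vert Q := if u is c :: _ then ltgt c else x.

Fixpoint composable x u : bool :=
  if u is c :: u' then (lsrc c == wtgt x u') && composable x u' else true.

Fixpoint arrows u : seq (arr Q) :=
  match u with
  | [::] => [::]
  | inl _ :: u' => arrows u'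
  | inr a :: u' => a :: arrows u'
  end.

Fixpoint waits u : seq nat :=
  match u with
  | [::] => [:: 0%N]
  | inl _ :: u' => incr_nth (waits u') 0
  | inr _ :: u' => 0%N :: waits u'
  end.

(** The words of the trajectories over w, recognized letter by letter: this form
    behaves well under concatenation and under deletion of a vertex letter. *)
Definition spells (w : qpath Q) u : bool := composable (psrc w) u && (arrows u == parr w).

Lemma size_waits u : size (waits u) = (size (arrows u)).+1.
Proof. by elim: u => [//|[y|a] u IH] /=; rewrite ?size_incr_nth ?IH. Qed.

Lemma wtgt_arrows x u : composable x u -> wtgt x u = tgt_seq x (arrows u).
Proof. by elim: u => [//|[y|a] u IH] //= /andP[/eqP-> /IH]. Qed.

Lemma is_path_arrows x u : composable x u -> is_path x (arrows u).
Proof.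
elim: u => [//|[y|a] u IH] //= /andP[/eqP ex cu]; first exact: IH.
by rewrite ex wtgt_arrows // eqxx IH.
Qed.

Lemma sumn_waits u : (size (arrows u) + sumn (waits u))%N = size u.
Proof.
elim: u => [//|[y|a] u IH] /=; rewrite -IH; last by rewrite add0n addSn.
by case: (waits u) => [|q p]; rewrite /= ?addSn addnS.
Qed.

Lemma traj_word_waits x u : composable x u -> traj_word x (arrows u) (waits u) = u.
Proof.
elim: u => [//|[y|a] u IH] /=; move=> /andP[/eqP ey cu]; last by rewrite IH.
rewrite -[in RHS](IH cu) ey wtgt_arrows //.
by move: (size_waits u); case: (waits u) => [//|q p] _; case: (arrows u).
Qed.

Lemma waits_traj_word x l p : size p = (size l).+1 -> waits (traj_word x l p) = p.
Proof.
elim: l p => [|a l IH] [|q p] //= [].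
  by move/eqP; rewrite size_eq0 => /eqP-> ; elim: q => //= q ->.
by move=> sp; elim: q => [|q IHq] /=; rewrite ?IH // IHq.
Qed.

Lemma arrows_traj_word x l p : arrows (traj_word x l p) = l.
Proof.
elim: l p => [|a l IH] p /=; first by rewrite cats0; elim: (head _ _).
by elim: (head _ _) => [|q IHq] //=; rewrite IH.
Qed.

Lemma wtgt_traj_word x l p : wtgt x (traj_word x l p) = tgt_seq x l.
Proof. by case: l => [|a l] /=; case: (head _ _). Qed.

Lemma composable_traj_word x l p : is_path x l -> composable x (traj_word x l p).
Proof.
have H z u q : wtgt x u = z -> composable x u -> composable x (nseq q (inl z) ++ u).
  move=> <- cu; elim: q => //= q ->; rewrite andbT; apply/eqP.
  by case: q.
elim: l p => [|a l IH] p /=; first by move=> _; apply: H.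
move=> /andP[/eqP sa pl]; apply: H => //=; rewrite wtgt_traj_word sa eqxx /=.
exact: IH.
Qed.

Lemma size_traj_word x l p : size p = (size l).+1 ->
  size (traj_word x l p) = (size l + sumn p)%N.
Proof.
by move=> sp; rewrite -(sumn_waits (traj_word x l p)) waits_traj_word // arrows_traj_word.
Qed.

Lemma arrows_cat u u' : arrows (u ++ u') = arrows u ++ arrows u'.
Proof. by elim: u => [//|[y|a] u IH] /=; rewrite IH. Qed.

Lemma composable_cat x u u' :
  composable x (u ++ u') = composable (wtgt x u') u && composable x u'.
Proof.
elim: u => [//|c u IH] /=; rewrite IH andbA; congr (_ && _ && _).
by case: u {IH}.
Qed.

Lemma wtgt_cat x u u' : wtgt x (u ++ u') = wtgt (wtgt x u') u.
Proof. by case: u. Qed.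

Lemma arrows_del u y u' : arrows (u ++ inl y :: u') = arrows (u ++ u').
Proof. by rewrite !arrows_cat. Qed.

Lemma composable_del x u y u' :
  composable x (u ++ inl y :: u') -> composable x (u ++ u').
Proof. by rewrite !composable_cat /= => /and3P[cu /eqP<- ->]; rewrite cu. Qed.

Lemma spells_del w u y u' : spells w (u ++ inl y :: u') -> spells w (u ++ u').
Proof. by move=> /andP[/composable_del cu]; rewrite arrows_del /spells cu. Qed.

(** Deleting a vertex letter lowers one waiting time by one, namely the one whose
    index is the number of arrows before that letter. *)
Lemma waits_del u y u' :
  waits (u ++ inl y :: u') = incr_nth (waits (u ++ u')) (size (arrows u)).
Proof.
elim: u => [//|[z|a] u IH] /=; rewrite IH //.
by move: (size_waits (u ++ u')); case: (waits _) => // q p _; case: (size _).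
Qed.

Lemma wtgt_spells w u : spells w u -> wtgt (psrc w) u = ptgt w.
Proof. by move=> /andP[cu /eqP au]; rewrite wtgt_arrows // au. Qed.

Lemma incr_nth_inj p i j : incr_nth p i = incr_nth p j -> i = j.
Proof.
move=> eij; have := congr1 (nth 0 ^~ i) eij.
rewrite !nth_incr_nth eqxx /=.
by case: (eqVneq j i) => [->//|_] /=; lia.
Qed.

Lemma wseq_trajs n (w : qpath Q) (p : (plen w).+1.-tuple 'I_n.+1) :
  (p \in trajs n w) = (plen w + sumn (wseq p) == n)%N.
Proof.
rewrite inE; congr (_ + _ == _)%N.
by rewrite sumnE /wseq big_map big_tuple.
Qed.

Lemma size_wseq m n (p : m.-tuple 'I_n) : size (wseq p) = m.
Proof. by rewrite size_map size_tuple. Qed.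

Lemma wseq_inj m n : injective (@wseq m n).
Proof. by move=> p q /(inj_map val_inj) /val_inj. Qed.

Definition tword (w : qpath Q) p : seq letter := traj_word (psrc w) (parr w) p.

Lemma tword_trajs n w (p : (plen w).+1.-tuple 'I_n.+1) : p \in trajs n w ->
  [/\ size (tword w (wseq p)) = n, spells w (tword w (wseq p)) &
      waits (tword w (wseq p)) = wseq p].
Proof.
rewrite wseq_trajs => /eqP np; split.
- by rewrite size_traj_word // size_wseq.
- by rewrite /spells composable_traj_word ?(valP w) // arrows_traj_word eqxx.
- by rewrite waits_traj_word // size_wseq.
Qed.

Lemma trajs_spells n w u : spells w u -> size u = n ->
  exists2 p : (plen w).+1.-tuple 'I_n.+1, p \in trajs n w & wseq p = waits u.
Proof.
move=> /andP[cu /eqP au] sun.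
have sw : size [seq inord q : 'I_n.+1 | q <- waits u] == (plen w).+1.
  by rewrite size_map size_waits au.
have le_wn q : q \in waits u -> (q < n.+1)%N.
  have sn : (sumn (waits u) <= n)%N by rewrite -sun -(sumn_waits u) leq_addl.
  rewrite ltnS => qw; apply: leq_trans sn.
  elim: (waits u) qw => //= r s IH; rewrite inE => /predU1P[->|/IH le_qs].
    exact: leq_addr.
  by apply: leq_trans le_qs _; apply: leq_addl.
have ep : wseq (Tuple sw) = waits u.
  rewrite /wseq /= -map_comp -[RHS]map_id; apply/eq_in_map => q /le_wn qn /=.
  by rewrite inordK.
by exists (Tuple sw) => //; rewrite wseq_trajs ep /plen -au sumn_waits sun.
Qed.

(** Sums over trajectories thus become sums over words; [traj_word] and [waits]
    are inverse to each other. *)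
Lemma perm_trajs n w :
  perm_eq [seq tword w (wseq t) | t <- enum (trajs n w)]
          [seq tval t | t <- enum [pred t : n.-tuple letter | spells w t]].
Proof.
apply: uniq_perm.
- rewrite map_inj_in_uniq ?enum_uniq // => p q; rewrite !mem_enum.
  move=> /tword_trajs[_ _ wp] /tword_trajs[_ _ wq] epq.
  by apply: wseq_inj; rewrite -wp -wq epq.
- by rewrite map_inj_uniq ?enum_uniq //; apply: val_inj.
- move=> u; apply/mapP/mapP => [[p]|[t]]; rewrite mem_enum.
    move=> /tword_trajs[/eqP sp op _] ->.
    by exists (Tuple sp); rewrite ?mem_enum.
  rewrite inE => ot ->; have [p pT ep] := trajs_spells ot (size_tuple t).
  exists p; rewrite ?mem_enum // ep /tword.
  by case/andP: ot => ct /eqP<-; rewrite traj_word_waits.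
Qed.

Lemma qpathP (w w' : qpath Q) : psrc w = psrc w' -> parr w = parr w' -> w = w'.
Proof.
move=> es ea; apply: val_inj.
by case: w w' es ea => [[x l] pl] [[x' l'] pl'] /=; rewrite /psrc /parr /= => -> ->.
Qed.

Lemma CQ_path_inj n : injective (@CQ_path Q n).
Proof.
move=> g g' egg; apply: val_inj; apply: val_inj.
move: egg; rewrite /CQ_path /to_qpath => /(congr1 val) /=.
by case: (val (val g)) (val (val g')) => [x l] [x' l'] /= [-> /val_inj->].
Qed.

Lemma CQ_path_cycle n (g : CQ Q n) : is_cycle (CQ_path g).
Proof. exact: valP g. Qed.

Lemma CQ_pathP n (w : qpath Q) : is_cycle w -> (plen w <= n)%N ->
  exists g : CQ Q n, CQ_path g = w.
Proof.
move=> cw lw; pose l : n.-bseq (arr Q) := Bseq lw.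
have pw : is_path (psrc w, l).1 (psrc w, l).2 by exact: valP w.
pose w0 : qpath_le Q n := exist (fun w : vert Q * n.-bseq (arr Q) => is_path w.1 w.2) (psrc w, l) pw.
have e0 : to_qpath w0 = w by apply: qpathP.
have c0 : is_cycle (to_qpath w0) by rewrite e0.
by exists (exist (fun w : qpath_le Q n => is_cycle (to_qpath w)) w0 c0).
Qed.

Lemma is_concatP (w' w0 w : qpath Q) : is_concat w' w0 w ->
  [/\ psrc w' = ptgt w0, psrc w = psrc w0, parr w = parr w' ++ parr w0 & ptgt w = ptgt w'].
Proof.
case/and3P=> /eqP e1 /eqP e2 /eqP e3; split=> //.
by rewrite /ptgt e3 e2; case: (parr w') e1 => [|a l] /=; rewrite ?e1.
Qed.

(** The arrows of the two words determine those of the paths, and the vertex at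
    which the paths meet is then the target of the second one. *)
Lemma is_concat_uniq w' w0 w1' w1 w u u' : is_concat w' w0 w -> is_concat w1' w1 w ->
  spells w' u -> spells w0 u' -> spells w1' u -> spells w1 u' -> w' = w1' /\ w0 = w1.
Proof.
move=> /is_concatP[e1 e2 e3 e4] /is_concatP[e1' e2' e3' e4'].
move=> /andP[_ /eqP a1] /andP[_ /eqP a2] /andP[_ /eqP a1'] /andP[_ /eqP a2'].
have e0 : w0 = w1 by apply: qpathP; rewrite -?e2 -?e2' // -a2 -a2'.
by split=> //; apply: qpathP; rewrite ?e1 ?e1' ?e0 // -a1 -a1'.
Qed.

Lemma spells_cat w' w0 w u u' : is_concat w' w0 w -> spells w' u -> spells w0 u' ->
  spells w (u ++ u').
Proof.
move=> /is_concatP[e1 e2 e3 e4] /andP[c1 /eqP a1] o0; have := o0 => /andP[c2 /eqP a2].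
by rewrite /spells composable_cat arrows_cat a1 a2 e3 e2 eqxx c2 wtgt_spells // -e1 c1.
Qed.

(** The arrows of u ++ u' are those of w' followed by those of w0, and cutting
    the list at the right place for one factor does so for the other. *)
Lemma spells_catl w' w0 w u u' : is_concat w' w0 w -> spells w (u ++ u') ->
  spells w0 u' = spells w' u.
Proof.
move=> /is_concatP[e1 e2 e3 e4]; rewrite /spells composable_cat arrows_cat e3.
case/andP=> /andP[c1 c2] /eqP ea; rewrite -e2 c2 /=.
apply/eqP/andP => [a2|[_ /eqP a1]]; last first.
  by move: ea; rewrite a1 => /(congr1 (drop (size (parr w')))); rewrite !drop_size_cat.
have a1 : arrows u = parr w'.
  by have := congr1 rev ea; rewrite !rev_cat a2 => /(congr1 (drop (size (rev (parr w0)))));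
     rewrite !drop_size_cat // => /(can_inj revK).
have o0 : spells w0 u' by rewrite /spells -e2 c2 a2 eqxx.
by rewrite a1; split=> //; rewrite e1 -(wtgt_spells o0) -e2.
Qed.

Lemma spells_split (w : qpath Q) u u' : spells w (u ++ u') ->
  exists w' w0, [/\ is_concat w' w0 w, spells w' u & spells w0 u'].
Proof.
rewrite /spells composable_cat arrows_cat => /andP[/andP[c1 c2] ea].
pose w0 : qpath Q := exist (fun u : vert Q * seq (arr Q) => is_path u.1 u.2)
  (psrc w, arrows u') (is_path_arrows c2).
pose w' : qpath Q := exist (fun u : vert Q * seq (arr Q) => is_path u.1 u.2)
  (wtgt (psrc w) u', arrows u) (is_path_arrows c1).
exists w', w0; rewrite /is_concat /psrc /parr /ptgt /= -/(psrc w) -/(parr w).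
by rewrite wtgt_arrows // !eqxx -wtgt_arrows //= eq_sym ea c1 c2.
Qed.

Lemma size_spells w u : spells w u -> (plen w <= size u)%N.
Proof.
by move=> /andP[_ /eqP au]; rewrite -(sumn_waits u) au leq_addr.
Qed.

End Words.


(** * Cochains evaluated on sequences *)

(** The signs of the Leibniz rule, in an abstract ring: the product of Lambda
    is by definition a sum, on which rewriting with ring identities would act. *)
Lemma leibniz_identity (R : pzRingType) n' n (x p q a b y z : R) (A : 'I_n' -> R) (B : 'I_n -> R) :
  x * (p * q)
  + (\sum_(i < n') (-1) ^+ i.+1 * (A i * q) + \sum_(i < n) (-1) ^+ (n' + i).+1 * (a * B i))
  + (-1) ^+ (n' + n).+1 * ((a * b) * z)
  = (x * p + \sum_(i < n') (-1) ^+ i.+1 * A i + (-1) ^+ n'.+1 * (a * y)) * q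
  + (-1) ^+ n' * (a * (y * q + \sum_(i < n) (-1) ^+ i.+1 * B i + (-1) ^+ n.+1 * (b * z))).
Proof.
rewrite !mulrDl !mulrDr -!addrA; congr (_ + _); first exact: mulrA.
rewrite mulr_suml; congr (_ + _); first by apply: eq_bigr => i _; apply: mulrA.
have -> : (-1) ^+ n'.+1 * (a * y) * q = - ((-1) ^+ n' * (a * (y * q))).
  by rewrite exprS mulN1r !mulNr !mulrA.
rewrite addKr.
have sgnC j (c : R) : (-1) ^+ n' * (a * ((-1) ^+ j * c)) = (-1) ^+ (n' + j) * (a * c).
  by rewrite [a * _]mulrA (commr_sign a j) !mulrA exprD.
rewrite sgnC addnS [a * (b * z)]mulrA !mulr_sumr; congr (_ + _).
by apply: eq_bigr => i _; rewrite sgnC addnS.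
Qed.

Section Evaluation.
Variables (k : fieldType) (Q : quiver) (Delta : Qset k Q).
Local Notation L := (Lam Delta).
Local Notation e := (vunit Delta).
Local Notation C := (cochain Delta).
Local Notation letter := (vert Q + arr Q)%type.
Implicit Types (V W : nat -> L) (u : seq letter).

(** Cochains are evaluated on sequences indexed by all of nat, of which they see
    the first n entries: shifts and merges of such sequences need no casts between
    ordinals with the same bound written in two ways. *)
Definition ev n (f : C n) V : L := f (fun i : 'I_n => V i).

Definition ext n (v : 'I_n -> L) : nat -> L := fun i => oapp v 0 (insub i).

Lemma extE n (v : 'I_n -> L) (i : 'I_n) : ext v i = v i.
Proof. by rewrite /ext valK. Qed.

Lemma ev_ext n (f : C n) v : ev f (ext v) = f v.
Proof. by congr f; apply: funext => i; apply: extE. Qed.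

Lemma cochainP n (f g : C n) : (forall V, ev f V = ev g V) -> f = g.
Proof. by move=> fg; apply: funext => v; rewrite -!ev_ext fg. Qed.

Lemma eq_ev n (f : C n) V W : (forall i, (i < n)%N -> V i = W i) -> ev f V = ev f W.
Proof. by move=> VW; congr f; apply: funext => i; apply: VW. Qed.

Lemma ev_sum n (I : Type) (r : seq I) (P : pred I) (F : I -> C n) V :
  ev (\sum_(i <- r | P i) F i) V = \sum_(i <- r | P i) ev (F i) V.
Proof. by rewrite /ev; elim/big_rec2: _ => // i x y _ <-. Qed.

Definition shift m V : nat -> L := fun i => V (m + i)%N.

Definition update V m x : nat -> L := fun i => if i == m then x else V i.

Definition contract m V : nat -> L := fun i =>
  if (i < m)%N then V i else if i == m then V i * V i.+1 else V i.+1.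

Lemma ev_hochd n (f : C n) V :
  ev (hochd f) V = V 0%N * ev f (shift 1 V)
  + \sum_(i < n) (-1) ^+ i.+1 *: ev f (contract i V)
  + (-1) ^+ n.+1 *: (ev f V * V n).
Proof. by []. Qed.

Lemma ev_cup n' n (f' : C n') (f : C n) V :
  ev (cup f' f) V = ev f' V * ev f (shift n' V).
Proof. by []. Qed.

(** The last term of d f' and the first term of d f cancel, as V n' is multiplied
    to the left in one and to the right in the other.  The rule is pointwise
    because the degrees n'.+1 + n and n' + n.+1 are not convertible. *)
Lemma hochd_cup n' n (f' : C n') (f : C n) V :
  ev (hochd (cup f' f)) V = ev (hochd f') V * ev f (shift n'.+1 V)
    + (-1) ^+ n' *: (ev f' V * ev (hochd f) (shift n' V)).
Proof.
rewrite !ev_hochd big_split_ord !lam_sign /=.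
under eq_bigr do rewrite lam_sign.
under [X in _ + (_ + X) + _ = _]eq_bigr do rewrite lam_sign.
under [X in _ = (_ + X + _) * _ + _]eq_bigr do rewrite lam_sign.
under [X in _ = _ + _ * (_ * (_ + X + _))]eq_bigr do rewrite lam_sign.
rewrite !ev_cup; set a := ev f' V; set z := shift n' V; set q := ev f (shift n'.+1 V).
have -> : ev f (shift 1 z) = q.
  by apply: eq_ev => i _; rewrite /z /shift add1n addSn addnS.
have -> : z 0%N = V n' by rewrite /z /shift addn0.
apply: etrans (leibniz_identity (V 0%N) (ev f' (shift 1 V)) q a (ev f z) (V n') (z n)
  (fun i => ev f' (contract i V)) (fun i => ev f (contract i z))).
congr (_ + (_ + _) + _).
  apply: eq_bigr => i _; rewrite ev_cup; congr (_ * (_ * _)).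
  apply: eq_ev => j _; rewrite /contract /shift /= ltnNge.
  have ij : (i <= n' + j)%N by rewrite (leq_trans (ltnW (ltn_ord i))) ?leq_addr.
  by rewrite ij /=; case: eqP => [E|_]; [have := ltn_ord i; lia | rewrite addSn].
apply: eq_bigr => i _; rewrite ev_cup; congr (_ * (_ * _)).
  by apply: eq_ev => j jn; rewrite /contract /= ltn_addr.
apply: eq_ev => j _; rewrite /contract /z /shift /= ltn_add2l eqn_add2l.
by rewrite addnS.
Qed.

Definition multilinear n (f : C n) : Prop :=
  forall V i, (i < n)%N -> linear (fun x => ev f (update V i x)).

(** D-bilinearity in one identity: each d i crosses one tensor sign, d 0 leaves
    on the left and d n on the right.  For n = 0 the value centralizes D. *)
Definition balanced n (f : C n) : Prop := forall (d : nat -> L) V, (forall i, inD (d i)) ->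
  ev f (fun i => d i * V i) * d n = d 0%N * ev f (fun i => V i * d i.+1).

Lemma Jpred_multilinear n (f : C n) : Jpred f -> multilinear f.
Proof.
case=> lf _ _ _ _ V i lin c x y.
have E z : ev f (update V i z) = f (upd (fun j : 'I_n => V j) (Ordinal lin) z) by [].
by rewrite !E lf.
Qed.

(** The families d for which the identity holds are closed under products, D being
    commutative, and each condition of [Jpred] is the case of a family with a
    single entry different from 1. *)
Lemma Jpred_balanced n (f : C n) : Jpred f -> balanced f.
Proof.
case=> _ f2 f3 f4 f5.
pose P (d : nat -> L) := (forall i, inD (d i)) /\ forall V,
  ev f (fun i => d i * V i) * d n = d 0%N * ev f (fun i => V i * d i.+1).
have PM d d' : P d -> P d' -> P (fun i => d i * d' i).
  move=> [Dd Ed] [Dd' Ed']; split=> [i|V]; first exact: inDM.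
  rewrite (_ : ev f _ = ev f (fun i => d i * (d' i * V i))); last first.
    by apply: eq_ev => i _; rewrite mulrA.
  rewrite mulrA Ed.
  rewrite (_ : ev f _ = ev f (fun i => d' i * (V i * d i.+1))); last first.
    by apply: eq_ev => i _; rewrite mulrA.
  rewrite -!mulrA Ed'; congr (_ * (_ * _)).
  by apply: eq_ev => i _; rewrite mulrA.
have P1 : P (fun=> 1).
  split=> [i|V]; first exact: inD1.
  by rewrite mul1r mulr1; apply: eq_ev => i _; rewrite mul1r mulr1.
have Psingle d j : inD d -> (j <= n)%N -> P (fun i => if i == j then d else 1).
  move=> Dd le_jn; split=> [i|V]; first by case: eqP => // _; apply: inD1.
  have [j0|j_gt0] := posnP j.
    rewrite j0 eqxx; case: (posnP n) => [n0|n_gt0].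
      have E0 W : ev f W = ev f V by congr f; apply: funext => -[i]; lia.
      by rewrite !E0 -[ev f V]/(f _) f5.
    rewrite mulr1 (_ : ev f (fun i => V i * _) = ev f V); last first.
      by apply: eq_ev => i _; rewrite mulr1.
    rewrite -[ev f V]/(f _) -(f3 _ (Ordinal n_gt0)) //; congr f; apply: funext => i.
    by rewrite /upd -val_eqE /=; case: eqP => [->|]; rewrite ?mul1r.
  rewrite (_ : (0%N == j) = false) ?mul1r; last by lia.
  case: eqP => [nj|/eqP ne_nj].
    have ltjn : (j.-1 < n)%N by lia.
    rewrite (_ : ev f (fun i => _ * V i) = ev f V); last first.
      apply: eq_ev => i ltin; rewrite (_ : (i == j) = false) ?mul1r //.
      by lia.
    rewrite -[ev f V]/(f _) -(f4 _ (Ordinal ltjn)) //=; last by lia.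
    congr f; apply: funext => i; rewrite /upd -val_eqE /=.
    rewrite (_ : (i.+1 == j) = (i == j.-1 :> nat)); last by lia.
    by case: eqP => [->|]; rewrite ?mulr1.
  rewrite mulr1; have ltjn : (j < n)%N by lia.
  have ltj1n : (j.-1 < n)%N by lia.
  have := f2 (fun i : 'I_n => V i) (Ordinal ltj1n) (Ordinal ltjn) d Dd.
  rewrite /= prednK // => /(_ erefl) f2j.
  transitivity (f (upd (fun i : 'I_n => V i) (Ordinal ltjn) (d * V j))).
    congr f; apply: funext => i; rewrite /upd -val_eqE /=.
    by case: eqP => [->|]; rewrite ?mul1r.
  rewrite -f2j; congr f; apply: funext => i; rewrite /upd -val_eqE /=.
  rewrite (_ : (i.+1 == j) = (i == j.-1 :> nat)); last by lia.
  by case: eqP => [->|]; rewrite ?mulr1.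
move=> d V Dd.
have Ptrunc m : (m <= n.+1)%N -> P (fun i => if (i < m)%N then d i else 1).
  elim: m => [|m IH] le_mn; first exact: P1.
  have /= := PM _ _ (IH (ltnW le_mn)) (Psingle (d m) m (Dd m) le_mn).
  congr P; apply: funext => i; rewrite ltnS.
  by case: (ltngtP i m) => [||->]; rewrite ?mul1r ?mulr1.
have [_ /(_ V)] := Ptrunc n.+1 (leqnn _); rewrite ltnSn /= => Ed.
transitivity (ev f (fun i => (if (i < n.+1)%N then d i else 1) * V i) * d n).
  by congr (_ * _); apply: eq_ev => i ltin; rewrite ltnS (ltnW ltin).
by rewrite Ed; congr (_ * _); apply: eq_ev => i ltin; rewrite ltnS ltin.
Qed.

Lemma JpredP n (f : C n) : multilinear f -> balanced f -> Jpred f.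
Proof.
move=> lf bf.
have E (v : 'I_n -> L) i x : f (upd v i x) = ev f (update (ext v) i x).
  rewrite /ev; congr f; apply: funext => j; rewrite /upd /update -val_eqE extE.
  by case: eqP.
pose s (j : nat) d : nat -> L := fun i => if i == j then d else 1.
have Ds j d : inD d -> forall i, inD (s j d i).
  by move=> Dd i; rewrite /s; case: eqP => // _; apply: inD1.
have Vs d j (v : 'I_n -> L) (i : 'I_n) :
    s j d i * ext v i = if i == j :> nat then d * v i else v i.
  by rewrite /s extE; case: eqP; rewrite ?mul1r.
have Ws d j (v : 'I_n -> L) (i : 'I_n) :
    ext v i * s j d i.+1 = if i.+1 == j :> nat then v i * d else v i.
  by rewrite /s extE; case: eqP; rewrite ?mulr1.
split.
- by move=> v i c x y; rewrite !E lf.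
- move=> v i j d Dd eji.
  have := bf _ (ext v) (Ds j d Dd).
  rewrite {2 3}/s eji /= (_ : (n == i.+1) = false); last by have := ltn_ord j; lia.
  rewrite mulr1 mul1r => Ef; transitivity (ev f (fun m => ext v m * s i.+1 d m.+1)).
    congr f; apply: funext => m; rewrite Ws /upd eqSS val_eqE.
    by case: eqP => [->|].
  rewrite -Ef; congr f; apply: funext => m; rewrite Vs /upd -eji val_eqE.
  by case: eqP => [->|].
- move=> v i d Dd i0.
  have := bf _ (ext v) (Ds 0%N d Dd).
  rewrite {2 3}/s eqxx (_ : (n == 0%N) = false); last by have := ltn_ord i; lia.
  rewrite mulr1 => Ef; transitivity (ev f (fun m => s 0%N d m * ext v m)).
    congr f; apply: funext => m; rewrite Vs /upd -i0 val_eqE.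
    by case: eqP => [->|].
  by rewrite Ef; congr (_ * f _); apply: funext => m; rewrite Ws.
- move=> v i d Dd eni.
  have := bf _ (ext v) (Ds n d Dd).
  rewrite {2 3}/s eqxx (_ : (0%N == n) = false); last by lia.
  rewrite mul1r => Ef; transitivity (ev f (fun m => ext v m * s n d m.+1)).
    congr f; apply: funext => m; rewrite Ws /upd.
    rewrite (_ : (m.+1 == n) = (m == i)); last by rewrite -val_eqE /=; lia.
    by case: eqP => [->|].
  rewrite -Ef; congr (f _ * _); apply: funext => m; rewrite Vs.
  by rewrite (_ : (m == n :> nat) = false) //; have := ltn_ord m; lia.
- move=> v d Dd n0; have := bf (fun=> d) (ext v) (fun=> Dd).
  have E0 W : ev f W = f v by congr f; apply: funext => -[m]; lia.
  by rewrite !E0.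
Qed.

End Evaluation.


(** * Components along paths *)
Section Components.
Variables (k : fieldType) (Q : quiver) (Delta : Qset k Q).
Local Notation L := (Lam Delta).
Local Notation e := (vunit Delta).
Local Notation C := (cochain Delta).
Local Notation pcomp := Defs.pcomp.
Local Notation letter := (vert Q + arr Q)%type.
Implicit Types (V W : nat -> L) (u : seq letter) (x : vert Q) (w : qpath Q).

(** The projection of V_0 (x) V_1 (x) ... onto the summand of the tensor power
    that belongs to the word u. *)
Definition cut u V : nat -> L := fun i => if drop i u is c :: _ then lcomp c (V i) else 0.

Lemma cutE c0 u V i : (i < size u)%N -> cut u V i = lcomp (nth c0 u i) (V i).
Proof. by move=> iu; rewrite /cut (drop_nth c0 iu). Qed.

Lemma cut_catl u u' V i : (i < size u)%N -> cut (u ++ u') V i = cut u V i.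
Proof. by move=> iu; rewrite /cut drop_cat iu; case: (drop i u) (size_drop i u) => //=; lia. Qed.

Lemma shift_cut u u' V : shift (size u) (cut (u ++ u') V) = cut u' (shift (size u) V).
Proof.
apply: funext => i; rewrite /shift /cut drop_cat ltnNge leq_addr /=.
by rewrite (_ : (size u + i - size u)%N = i) //; lia.
Qed.

Lemma ev_cut_catl n (f : C n) u u' V : size u = n -> ev f (cut (u ++ u') V) = ev f (cut u V).
Proof. by move=> su; apply: eq_ev => i lin; rewrite cut_catl // su. Qed.

Lemma ev_eq0 n (f : C n) V i : multilinear f -> (i < n)%N -> V i = 0 -> ev f V = 0.
Proof.
move=> lf lin Vi0; rewrite -(linear_fun0 (lf V i lin)); apply: eq_ev => j _.
by rewrite /update; case: eqP => [->|].
Qed.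

(** Two words that differ at some place project the corresponding entry to two
    different summands of Lambda. *)
Lemma ev_cut_cut n (f : C n) u u' V : multilinear f -> size u = n -> size u' = n ->
  ev f (cut u (cut u' V)) = if u == u' then ev f (cut u V) else 0.
Proof.
move=> lf su su'; case: eqVneq => [<-|ne_uu'].
  apply: eq_ev => i _; rewrite /cut.
  by case: (drop i u) => [//|c _]; rewrite lcomp_lcomp eqxx.
case: u su ne_uu' => [|c0 u0] su ne_uu'.
  by case: u' su' ne_uu' => // c u'; rewrite -[RHS]su.
have [/existsP[i ne_i]|/existsPn eq_uu'] :=
    boolP [exists i : 'I_n, nth c0 (c0 :: u0) i != nth c0 u' i].
  apply: (ev_eq0 (i := i)) => //.
  by rewrite (cutE c0) ?su // (cutE c0) ?su' // lcomp_lcomp (negbTE ne_i).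
case/eqP: ne_uu'; apply: (@eq_from_nth _ c0) => [|i]; rewrite su // => lin.
by apply/eqP; have := eq_uu' (Ordinal lin); rewrite negbK.
Qed.

(** On a word from x to y, a balanced cochain has values in e_y Lambda e_x.  With
    one idempotent on each side this also holds for the empty word, where the value
    only commutes with the idempotents. *)
Lemma balanced_cut n (f : C n) x u V : balanced f -> composable x u -> size u = n ->
  e (wtgt x u) * ev f (cut u V) = ev f (cut u V) * e x.
Proof.
move=> bf cu su; pose d i := e (wtgt x (drop i u)).
have cd i c u' : drop i u = c :: u' -> lsrc c = wtgt x u'.
  move=> du; move: cu; rewrite -(cat_take_drop i u) composable_cat du /=.
  by case/and3P=> _ /eqP.
have dS i c u' : drop i u = c :: u' -> drop i.+1 u = u'.
  by move=> du; rewrite -[i.+1]addn1 addnC -drop_drop du /= drop0.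
have dn : d n = e x by rewrite /d -su drop_size.
have d0 : d 0%N = e (wtgt x u) by rewrite /d drop0.
have Dd i : inD (d i) by apply: inD_vunit.
have Vd i : d i * cut u V i = cut u V i.
  by rewrite /cut /d; case: (drop i u) => [|c u']; rewrite ?mulr0 //= lcomp_tgt.
have dV i : cut u V i * d i.+1 = cut u V i.
  rewrite /cut /d; case E: (drop i u) => [|c u']; first by rewrite mul0r.
  by rewrite (dS _ _ _ E) -(cd _ _ _ E) lcomp_src.
rewrite -dn -d0; have := bf d (cut u V) Dd.
by rewrite (funext Vd) (funext dV).
Qed.


Lemma ev_tcomp n w p (f : C n) V : size (tword w p) = n ->
  ev (tcomp w p f) V = e (ptgt w) * ev f (cut (tword w p) V) * e (psrc w).
Proof.
move=> sw; congr (_ * f _ * _); apply: funext => i.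
by rewrite (cutE (inl (psrc w))) // sw.
Qed.

Lemma ev_pcomp n w (f : C n) V :
  ev (pcomp w f) V =
  \sum_(u : n.-tuple letter | spells w u) e (ptgt w) * ev f (cut u V) * e (psrc w).
Proof.
pose F u := e (ptgt w) * ev f (cut u V) * e (psrc w).
rewrite /pcomp ev_sum.
transitivity (\sum_(u <- [seq tword w (wseq t) | t <- enum (trajs n w)]) F u).
  rewrite big_map big_enum /=; apply: eq_bigr => p /tword_trajs[sp _ _].
  by rewrite ev_tcomp.
rewrite (perm_big _ (perm_trajs n w)) big_map /=.
by rewrite big_enum.
Qed.

Lemma Jpred_tcomp n w p (f : C n) : Jpred f -> Jpred (tcomp w p f).
Proof.
move=> Jf; have lf := Jpred_multilinear Jf; have bf := Jpred_balanced Jf.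
pose c i := nth (inl (psrc w)) (traj_word (psrc w) (parr w) p) i.
have E V : ev (tcomp w p f) V =
    e (ptgt w) * ev f (fun i => lcomp (c i) (V i)) * e (psrc w) by [].
apply: JpredP => [V i lin r x y|d V Dd].
  have U z : ev (tcomp w p f) (update V i z) = e (ptgt w)
      * ev f (update (fun j => lcomp (c j) (V j)) i (lcomp (c i) z)) * e (psrc w).
    rewrite E; congr (_ * _ * _); apply: eq_ev => j _; rewrite /update.
    by case: eqP => [->|].
  by rewrite !U lcomp_linear lf // mulrDr mulrDl -lam_scalerAr -lam_scalerAl.
rewrite !E -[LHS]mulrA (inD_comm (inD_vunit _ _) (Dd n)) mulrA [RHS]mulrA [d 0%N * _]mulrA.
rewrite (inD_comm (Dd 0%N) (inD_vunit _ _)); congr (_ * _).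
rewrite -!mulrA; congr (_ * _).
transitivity (ev f (fun i => d i * lcomp (c i) (V i)) * d n).
  by congr (_ * _); apply: eq_ev => i _; rewrite lcomp_inDl.
by rewrite bf //; congr (_ * _); apply: eq_ev => i _; rewrite lcomp_inDr.
Qed.

Lemma Jpred_pcomp n w (f : C n) : Jpred f -> Jpred (pcomp w f).
Proof.
move=> Jf; apply: (big_ind (@Jpred _ _ Delta n)) => [|g h|p _].
- exact: Jpred_0.
- exact: (subspaceD (S := Jsp Delta n)).
- exact: Jpred_tcomp.
Qed.

Lemma ev_pcomp_cut n w (f : C n) u V : multilinear f -> size u = n ->
  ev (pcomp w f) (cut u V) =
  if spells w u then e (ptgt w) * ev f (cut u V) * e (psrc w) else 0.
Proof.
move=> lf su; rewrite ev_pcomp.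
under eq_bigr do rewrite ev_cut_cut // ?size_tuple //.
case: ifP => [ou|nou]; last first.
  apply: big1 => t ot; case: eqP => [et|_]; last by rewrite mulr0 mul0r.
  by move: nou; rewrite -et ot.
have /eqP su' := su; rewrite (bigD1 (Tuple su')) //= eqxx big1 ?addr0 // => t /andP[_].
by rewrite -val_eqE /= => /negbTE->; rewrite mulr0 mul0r.
Qed.

Lemma pcomp_id n w (f : C n) : multilinear f -> pcomp w (pcomp w f) = pcomp w f.
Proof.
move=> lf; apply: cochainP => V; rewrite !ev_pcomp; apply: eq_bigr => t ot.
rewrite ev_pcomp_cut ?size_tuple // ot !mulrA vunitK -!mulrA.
by rewrite vunitK.
Qed.

(** Distinct paths have no common word except the empty one, which runs over every
    vertex; there the idempotents at the ends distinguish the vertices. *)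
Lemma pcomp_orth n w w' (f : C n) : multilinear f -> w <> w' -> pcomp w (pcomp w' f) = 0.
Proof.
move=> lf ne_ww'; apply: cochainP => V; rewrite ev_pcomp; apply: big1 => t ot.
rewrite ev_pcomp_cut ?size_tuple //; case: ifP => ot'; last by rewrite mulr0 mul0r.
rewrite -!mulrA vunitM; case: eqP => es; last by rewrite !mulr0.
case: ne_ww'; apply: qpathP => //.
by case/andP: ot => _ /eqP<-; case/andP: ot' => _ /eqP<-.
Qed.

Lemma tcomp_pcomp n w (t : (plen w).+1.-tuple 'I_n.+1) (f : C n) : multilinear f ->
  t \in trajs n w -> tcomp w (wseq t) (pcomp w f) = tcomp w (wseq t) f.
Proof.
move=> lf /tword_trajs[st ot _]; apply: cochainP => V.
rewrite !ev_tcomp // ev_pcomp_cut // ot !mulrA vunitK -!mulrA.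
by rewrite vunitK.
Qed.

End Components.


(** * The differential along a cycle *)

(** Reduces an identity between sums of Hochschild coboundaries, sandwiched
    between two idempotents, to its first, inner and last terms. *)
Lemma sandwiched_hochschild_sum (R : pzRingType) (I : finType) (P : pred I) n
    (e1 e2 a z : R) (m : 'I_n -> R) (a' z' : I -> R) (m' : I -> 'I_n -> R) :
  \sum_(b | P b) e1 * a' b * e2 = e1 * a * e2 ->
  (forall i, \sum_(b | P b) e1 * m' b i * e2 = e1 * m i * e2) ->
  \sum_(b | P b) e1 * z' b * e2 = e1 * z * e2 ->
  \sum_(b | P b) e1 * (a' b + \sum_(i < n) (-1) ^+ i.+1 * m' b i + (-1) ^+ n.+1 * z' b) * e2
  = e1 * (a + \sum_(i < n) (-1) ^+ i.+1 * m i + (-1) ^+ n.+1 * z) * e2.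
Proof.
move=> Ea Em Ez.
have sgn j (c : R) : e1 * ((-1) ^+ j * c) * e2 = (-1) ^+ j * (e1 * c * e2).
  by rewrite [e1 * _]mulrA (commr_sign e1 j) !mulrA.
under eq_bigr do rewrite !mulrDr !mulrDl sgn mulr_sumr mulr_suml.
rewrite !big_split /= Ea -mulr_sumr Ez exchange_big /=.
rewrite !mulrDr !mulrDl sgn mulr_sumr mulr_suml; congr (_ + _ + _).
apply: eq_bigr => i _; rewrite sgn -Em mulr_sumr.
by apply: eq_bigr => b _; apply: sgn.
Qed.

Section PathDifferential.
Variables (k : fieldType) (Q : quiver) (Delta : Qset k Q).
Local Notation L := (Lam Delta).
Local Notation e := (vunit Delta).
Local Notation C := (cochain Delta).
Local Notation pcomp := Defs.pcomp.
Local Notation letter := (vert Q + arr Q)%type.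
Implicit Types (V W : nat -> L) (u : seq letter) (x : vert Q) (w : qpath Q).

(** The pairs (p, i) through which the trajectory q occurs in [Kd]: q is p waiting
    one unit longer at the i-th stop. *)
Definition longer n w (q : (plen w).+1.-tuple 'I_n.+2)
    (b : (plen w).+1.-tuple 'I_n.+1 * 'I_(plen w).+1) : bool :=
  (b.1 \in trajs n w) && (wseq q == incr_nth (wseq b.1) b.2).

Lemma sumn_incr (s : seq nat) j : (j < size s)%N -> sumn (incr_nth s j) = (sumn s).+1.
Proof.
elim: s j => [|a s IH] [|j] //=; rewrite ltnS => js.
by rewrite IH // addnS.
Qed.

Lemma incr_trajs n w (p : (plen w).+1.-tuple 'I_n.+1) (j : 'I_(plen w).+1) :
  p \in trajs n w -> exists2 q : (plen w).+1.-tuple 'I_n.+2,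
    q \in trajs n.+1 w & wseq q = incr_nth (wseq p) j.
Proof.
rewrite wseq_trajs => /eqP np; set s := incr_nth _ _.
have ss : size s = (plen w).+1 by rewrite size_incr_nth size_wseq ltn_ord.
have os : spells w (tword w s).
  by rewrite /spells composable_traj_word ?(valP w) // arrows_traj_word eqxx.
have zs : size (tword w s) = n.+1.
  by rewrite size_traj_word // sumn_incr ?size_wseq // addnS np.
have [q qT eq] := trajs_spells os zs.
by exists q; rewrite // eq waits_traj_word.
Qed.

(** Collects the terms of the differential according to the trajectory on which
    they live; lengthening p determines q. *)
Lemma Kd_longer n w (f : C n) :
  Kd w f = \sum_(q in trajs n.+1 w) \sum_(b | longer q b)
    tcomp w (wseq q) (hochd (tcomp w (wseq b.1) f)).
Proof.
rewrite (exchange_big_dep (fun b => b.1 \in trajs n w)) /=; last first.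
  by move=> q b _ /andP[].
rewrite /Kd pair_big_dep /=; apply: eq_big => [[p j]|[p j]]; rewrite ?andbT //= => pT.
have [q qT eq] := incr_trajs j pT.
rewrite (bigD1 q) /=; last by rewrite qT /longer pT eq /=.
rewrite big1 ?addr0 ?eq // => q' /andP[/andP[_ /andP[_ /eqP eq']] /eqP[]].
by apply: wseq_inj; rewrite eq.
Qed.

(** On entries projected to u1 ++ u2, only the trajectory with this word has a
    nonzero component, and q is obtained by lengthening it at one place only. *)
Lemma sum_longer n w (q : (plen w).+1.-tuple 'I_n.+2) (f : C n) u1 x u2 W :
  multilinear f -> q \in trajs n.+1 w -> tword w (wseq q) = u1 ++ inl x :: u2 ->
  \sum_(b | longer q b) ev (tcomp w (wseq b.1) f) (cut (u1 ++ u2) W)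
  = e (ptgt w) * ev f (cut (u1 ++ u2) W) * e (psrc w).
Proof.
move=> lf qT eq; have [sq oq wq] := tword_trajs qT.
have or : spells w (u1 ++ u2) by apply: (spells_del (y := x)); rewrite -eq.
have sr : size (u1 ++ u2) = n.
  by move: sq; rewrite eq !size_cat /= addnS => -[].
have [p0 p0T ep0] := trajs_spells or sr.
have tp0 : tword w (wseq p0) = u1 ++ u2.
  by case/andP: or => cr /eqP ar; rewrite ep0 /tword -ar traj_word_waits.
have lt_j0 : (size (arrows u1) < (plen w).+1)%N.
  by case/andP: or => _ /eqP ar; rewrite ltnS /plen -ar arrows_cat size_cat leq_addr.
have wq' : wseq q = incr_nth (wseq p0) (size (arrows u1)).
  by rewrite -wq eq waits_del ep0.
rewrite (bigD1 (p0, Ordinal lt_j0)) /=; last by rewrite /longer p0T wq' /=.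
rewrite big1 ?addr0.
  by rewrite ev_tcomp tp0 // ev_cut_cut // eqxx.
move=> [p j] /andP[/andP[/= pT /eqP wp] ne_pj]; have [sp op wtp] := tword_trajs pT.
rewrite ev_tcomp // ev_cut_cut //; case: eqP => [etp|_]; last by rewrite mulr0 mul0r.
have epp : p = p0 by apply: wseq_inj; rewrite -wtp etp ep0.
case/eqP: ne_pj; congr (_, _); first by [].
by apply: val_inj; apply: (@incr_nth_inj (wseq p0)) => /=; rewrite -wq' wp epp.
Qed.

(** Merging the letters c1 c2 of a word into the letter c: off the merged place the
    two words agree up to the shift, and there the hypothesis applies. *)
Lemma contract_cut u1 c1 c2 c u3 V j :
  (forall v1 v2, lcomp c (lcomp c1 v1 * lcomp c2 v2) = lcomp c1 v1 * lcomp c2 v2 :> L) ->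
  (j < size (u1 ++ c :: u3))%N ->
  let W := contract (size u1) (cut (u1 ++ c1 :: c2 :: u3) V) in
  cut (u1 ++ c :: u3) W j = W j.
Proof.
move=> cM js W; rewrite {1}/cut; case: (ltngtP j (size u1)) => [ltj|gtj|ej].
- rewrite (drop_nth c js) nth_cat ltj /W /contract ltj (cutE c); last first.
    by rewrite size_cat ltn_addr.
  by rewrite nth_cat ltj lcomp_lcomp eqxx.
- rewrite (drop_nth c js) /W /contract ltnNge ltnW //= gtn_eqF //.
  rewrite (cutE c); last by move: js; rewrite !size_cat /=; lia.
  have [m ->] : exists m, j = (size u1 + m.+1)%N by exists (j - (size u1).+1)%N; lia.
  rewrite -addnS !nth_cat !(ltnNge (size u1 + _)) !leq_addr /= !addKn /=.
  by rewrite lcomp_lcomp eqxx.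
- rewrite ej drop_size_cat // /W /contract ltnn eqxx !(cutE c) ?size_cat /=; try lia.
  rewrite !nth_cat ltnn subnn ltnNge leqnSn subSnn /=.
  exact: cM.
Qed.

(** Merging two letters of the word of q deletes a vertex letter, and [sum_longer]
    applies, unless both are arrows, in which case their product is zero. *)
Lemma longer_sum_contract n w (q : (plen w).+1.-tuple 'I_n.+2) (f : C n) (i : 'I_n) V :
  zero_compositions Delta -> multilinear f -> q \in trajs n.+1 w ->
  \sum_(b | longer q b) e (ptgt w)
    * ev (tcomp w (wseq b.1) f) (contract i (cut (tword w (wseq q)) V)) * e (psrc w)
  = e (ptgt w) * ev f (contract i (cut (tword w (wseq q)) V)) * e (psrc w).
Proof.
move=> zD lf qT; have [sq oq wq] := tword_trajs qT.
set u := tword w (wseq q).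
(* A default letter: the word is not empty. *)
have [c0 _] : exists c : letter, True.
  by move: sq; rewrite -/u; case: u => [|c] //; exists c.
have [u1 [c1 [c2 [u3 [eu su1]]]]] : exists u1 c1 c2 u3,
    u = u1 ++ [:: c1, c2 & u3] /\ size u1 = i.
  have lti : (i < size u)%N by rewrite sq ltnS ltnW.
  have lti1 : (i.+1 < size u)%N by rewrite sq ltnS.
  exists (take i u), (nth c0 u i), (nth c0 u i.+1), (drop i.+2 u).
  by rewrite -!drop_nth // cat_take_drop size_take lti.
set W := contract i (cut u V).
suff E u1' x u2' c u0 : u1' ++ inl x :: u2' = u -> u1' ++ u2' = u1 ++ c :: u0 ->
    (forall j, (j < n)%N -> cut (u1 ++ c :: u0) W j = W j) ->
    \sum_(b | longer q b) e (ptgt w) * ev (tcomp w (wseq b.1) f) W * e (psrc w)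
    = e (ptgt w) * ev f W * e (psrc w).
  have cutW c : (forall v1 v2, lcomp c (lcomp c1 v1 * lcomp c2 v2) = lcomp c1 v1 * lcomp c2 v2 :> L) ->
      forall j, (j < n)%N -> cut (u1 ++ c :: u3) W j = W j.
    move=> cM j ltjn; rewrite /W eu -su1; apply: contract_cut => //.
    by move: sq; rewrite -/u eu !size_cat /= !addnS => -[->].
  case: c1 eu cutW => [y|a] eu cutW.
    by apply: (E u1 y (c2 :: u3) c2 u3) => //; apply: cutW => *; apply: lcomp_mulV.
  case: c2 eu cutW => [y|b] eu cutW.
    apply: (E (rcons u1 (inr a)) y u3 (inr a) u3); rewrite ?cat_rcons //.
    by apply: cutW => *; apply: lcomp_mulVr.
  have Wi : W i = 0.
    rewrite /W eu -su1 /contract ltnn eqxx !(cutE (inr a)) ?size_cat /=; try lia.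
    rewrite !nth_cat ltnn subnn ltnNge leqnSn subSnn /=.
    by apply: mul_inM0.
  rewrite (ev_eq0 lf (ltn_ord i) Wi) mulr0 mul0r big1 // => b1 /andP[pT _].
  have [sp _ _] := tword_trajs pT; rewrite ev_tcomp // (ev_eq0 (i := i) lf) ?(mulr0, mul0r) //.
  rewrite /cut; case: (drop i (tword w (wseq b1.1))) => // c _; rewrite Wi.
  exact: (linear_fun0 (lcomp_linear _)).
move=> eq1 eq2 cutW.
have evW (g : C n) : ev g W = ev g (cut (u1' ++ u2') W).
  by apply: eq_ev => j ltjn; rewrite eq2 cutW.
under eq_bigr do rewrite evW.
rewrite -mulr_suml -mulr_sumr (sum_longer _ lf qT (esym eq1)) evW.
by rewrite !mulrA vunitK -!mulrA vunitK.
Qed.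

Lemma vunit_sandwich_mul0 x y (v1 v2 : L) : x != y -> (v1 * e x) * (e y * v2) = 0.
Proof.
by move=> xy; rewrite mulrA -[v1 * _ * _]mulrA vunitM (negbTE xy) mulr0 mul0r.
Qed.

(** An initial vertex letter can be deleted.  An initial arrow a makes both sides
    vanish: on the left, its source differs from t(w), the target of the values of
    the f_p; on the right, f takes its values in e_(s(a)) Lambda e_(s(w)), inside M
    because s(w) = t(w) = t(a) and a is not a loop. *)
Lemma longer_sum_first n w (q : (plen w).+1.-tuple 'I_n.+2) (f : C n) V :
  (forall a : arr Q, src a <> tgt a) -> zero_compositions Delta -> is_cycle w ->
  Jpred f -> q \in trajs n.+1 w ->
  let W := cut (tword w (wseq q)) V in
  \sum_(b | longer q b) e (ptgt w)
    * (W 0%N * ev (tcomp w (wseq b.1) f) (shift 1 W)) * e (psrc w)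
  = e (ptgt w) * (W 0%N * ev f (shift 1 W)) * e (psrc w).
Proof.
move=> nl zD /eqP cw Jf qT W; have lf := Jpred_multilinear Jf.
have bf := Jpred_balanced Jf; have [sq oq wq] := tword_trajs qT.
rewrite {}/W; case eu : (tword w (wseq q)) => [|c u]; first by move: sq; rewrite eu.
have sW : shift 1 (cut (c :: u) V) = cut u (shift 1 V) by rewrite -(shift_cut [:: c]).
have su : size u = n by move: sq; rewrite eu => -[].
have ct : ltgt c = ptgt w by rewrite -(wtgt_spells oq) eu.
have cu : composable (psrc w) u by case/andP: oq; rewrite eu => /andP[_].
have cs : lsrc c = wtgt (psrc w) u by case/andP: oq; rewrite eu => /andP[/eqP].
rewrite sW [cut (c :: u) V 0%N]/(lcomp c (V 0%N)).
set W := shift 1 V; have vE := lcomp_src c (V 0%N); set v := lcomp c _ in vE *.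
case: c => [x|a] in eu ct cs v vE sW *.
  rewrite /= in ct vE; rewrite ct in vE.
  rewrite -mulr_suml -mulr_sumr -mulr_sumr (sum_longer (u1 := [::]) _ lf qT eu) /=.
  by rewrite !mulrA -[e _ * v * e _]mulrA vE -!mulrA vunitK.
have ne_a : src a != ptgt w by rewrite -ct; apply/eqP/nl.
rewrite [v * ev f _](_ : _ = 0) ?mulr0 ?mul0r; last first.
  rewrite -vE -mulrA; apply: mul_inM0 => // y; rewrite cs -vunitK -mulrA.
  by rewrite balanced_cut // mulrA -cs peirce_off_diag //= cw.
apply: big1 => b /andP[/tword_trajs[sp _ _] _].
by rewrite ev_tcomp // -[X in _ * (X * _)]/v -vE -[e _ * ev _ _ * _]mulrA vunit_sandwich_mul0 // mulr0 mul0r.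
Qed.

(** The mirror image of [longer_sum_first]. *)
Lemma longer_sum_last n w (q : (plen w).+1.-tuple 'I_n.+2) (f : C n) V :
  (forall a : arr Q, src a <> tgt a) -> zero_compositions Delta -> is_cycle w ->
  Jpred f -> q \in trajs n.+1 w ->
  let W := cut (tword w (wseq q)) V in
  \sum_(b | longer q b) e (ptgt w)
    * (ev (tcomp w (wseq b.1) f) W * W n) * e (psrc w)
  = e (ptgt w) * (ev f W * W n) * e (psrc w).
Proof.
move=> nl zD /eqP cw Jf qT W; have lf := Jpred_multilinear Jf.
have bf := Jpred_balanced Jf; have [sq oq wq] := tword_trajs qT.
rewrite {}/W; case/lastP eu : (tword w (wseq q)) => [|u c]; first by move: sq; rewrite eu.
rewrite -cats1 in eu *.
have su : size u = n by move: sq; rewrite eu size_cat addn1 => -[].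
have evW (g : C n) : ev g (cut (u ++ [:: c]) V) = ev g (cut u V) by apply: ev_cut_catl.
have ou : composable (ltgt c) u.
  by case/andP: oq; rewrite eu composable_cat => /andP[].
have cs : lsrc c = psrc w.
  by case/andP: oq; rewrite eu composable_cat /= andbT => /andP[_ /eqP].
have ct : wtgt (ltgt c) u = ptgt w by rewrite -(wtgt_spells oq) eu wtgt_cat.
have -> : cut (u ++ [:: c]) V n = lcomp c (V n) by rewrite /cut -su drop_size_cat.
have vE := lcomp_tgt c (V n); set v := lcomp c _ in vE *; rewrite evW.
under eq_bigr do rewrite evW.
case: c => [x|a] in eu ou cs ct v vE evW *.
  rewrite /= in cs vE; rewrite cs in vE.
  have := sum_longer V lf qT eu; rewrite cats0 => sumE.
  rewrite -mulr_suml -mulr_sumr -mulr_suml sumE.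
  by rewrite !mulrA vunitK -!mulrA [e _ * (v * _)]mulrA vE.
have ne_a : psrc w != tgt a by rewrite -cs; apply/eqP/nl.
rewrite [ev f _ * v](_ : _ = 0) ?mulr0 ?mul0r; last first.
  rewrite -vE mulrA; apply: mul_inM0 => // y; rewrite -vunitK mulrA.
  by rewrite -balanced_cut // ct peirce_off_diag // -cw.
apply: big1 => b /andP[/tword_trajs[sp _ _] _].
by rewrite ev_tcomp // -vE vunit_sandwich_mul0 // mulr0 mul0r.
Qed.

(** Over a cycle, the components of d f only involve the components of f over the
    same cycle. *)
Lemma Kd_hochd n w (f : C n) : (forall a : arr Q, src a <> tgt a) ->
  zero_compositions Delta -> is_cycle w -> Jpred f -> Kd w f = Defs.pcomp w (hochd f).
Proof.
move=> nl zD cw Jf; rewrite Kd_longer; apply: eq_bigr => q qT.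
have [sq oq _] := tword_trajs qT.
apply: cochainP => V; rewrite ev_sum ev_tcomp //.
have hochdE (g : C n) W : ev (hochd g) W = W 0%N * ev g (shift 1 W)
    + \sum_(i < n) (-1) ^+ i.+1 * ev g (contract i W) + (-1) ^+ n.+1 * (ev g W * W n).
  by rewrite ev_hochd lam_sign; congr (_ + _ + _); apply: eq_bigr => i _; rewrite lam_sign.
rewrite hochdE -(sandwiched_hochschild_sum (longer_sum_first V nl zD cw Jf qT)
  (fun i => longer_sum_contract i V zD (Jpred_multilinear Jf) qT) (longer_sum_last V nl zD cw Jf qT)).
by apply: eq_bigr => b _; rewrite ev_tcomp // hochdE.
Qed.

End PathDifferential.


(** * Cup products and concatenation of paths *)
Lemma sum_tuple_cat (T : finType) (R : nmodType) N n' n (P : pred (seq T)) (F : seq T -> R) :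
  N = (n' + n)%N ->
  \sum_(u : N.-tuple T | P u) F u
  = \sum_(u : n'.-tuple T) \sum_(t : n.-tuple T | P (u ++ t)) F (u ++ t).
Proof.
move=> ->; rewrite pair_big_dep /=.
rewrite (reindex (fun p : n'.-tuple T * n.-tuple T => cat_tuple p.1 p.2)) //=.
apply: onW_bij; apply: inj_card_bij => [[u t] [u' t'] /(congr1 val) /= /eqP|].
  by rewrite eqseq_cat ?size_tuple // => /andP[/eqP/val_inj-> /eqP/val_inj->].
by rewrite card_prod !card_tuple expnD.
Qed.

Lemma sandwich_signed_add (R : pzRingType) (I : finType) (P : pred I) (e1 e2 : R) n (a b : I -> R) :
  \sum_(i | P i) e1 * (a i + (-1) ^+ n * b i) * e2
  = \sum_(i | P i) e1 * a i * e2 + (-1) ^+ n * \sum_(i | P i) e1 * b i * e2.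
Proof.
rewrite mulr_sumr -big_split; apply: eq_bigr => i _ /=.
by rewrite mulrDr mulrDl [e1 * (_ * _)]mulrA (commr_sign e1 n) !mulrA.
Qed.

Section CupProduct.
Variables (k : fieldType) (Q : quiver) (Delta : Qset k Q).
Local Notation L := (Lam Delta).
Local Notation e := (vunit Delta).
Local Notation C := (cochain Delta).
Local Notation pcomp := Defs.pcomp.
Local Notation letter := (vert Q + arr Q)%type.
Implicit Types (V W : nat -> L) (u : seq letter) (x : vert Q) (w : qpath Q).

Lemma Jpred_cup n' n (f' : C n') (f : C n) : Jpred f' -> Jpred f -> Jpred (cup f' f).
Proof.
move=> Jf' Jf; have [lf' lf] := (Jpred_multilinear Jf', Jpred_multilinear Jf).
have [bf' bf] := (Jpred_balanced Jf', Jpred_balanced Jf).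
apply: JpredP => [V i lin c x y|d V Dd].
  rewrite !ev_cup; have [lt_in'|le_n'i] := ltnP i n'.
    have E z : ev f (shift n' (update V i z)) = ev f (shift n' V).
      apply: eq_ev => j _; rewrite /shift /update; case: eqP => // E.
      by move: lt_in'; rewrite -E; lia.
    by rewrite !E lf' // mulrDl -lam_scalerAl.
  have E z : ev f' (update V i z) = ev f' V.
    by apply: eq_ev => j ltj; rewrite /update; case: eqP => // E; lia.
  have E' z : shift n' (update V i z) = update (shift n' V) (i - n')%N z.
    apply: funext => j; rewrite /shift /update.
    by rewrite (_ : (n' + j == i)%N = (j == i - n')%N) //; lia.
  have lt : (i - n' < n)%N by lia.
  by rewrite !E !E' lf // mulrDr -lam_scalerAr.
rewrite !ev_cup -mulrA.
transitivity (ev f' (fun i => d i * V i) *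
   (ev f (fun i => d (n' + i)%N * shift n' V i) * d (n' + n)%N)) => //.
rewrite (bf (fun i => d (n' + i)%N)) // mulrA addn0 bf' // mulrA; congr (_ * _).
by apply: eq_ev => i _; rewrite /shift addnS.
Qed.

(** G selects the words whose last n letters run over w0, and the first n' letters
    then run over w'.  No condition on X is imposed, in order to take X = d F, and
    N is a free name for n' + n, in order to take N = (n' + n).+1. *)
Lemma sum_cup_pathr n' n N (X : C n') (G : C n) w' w0 w V :
  N = (n' + n)%N -> is_concat w' w0 w -> multilinear G -> G = pcomp w0 G ->
  \sum_(u : N.-tuple letter | spells w u)
     e (ptgt w) * (ev X (cut u V) * ev G (shift n' (cut u V))) * e (psrc w)
  = ev (pcomp w' X) V * ev G (shift n' V).
Proof.
move=> eN c lG eG; have [ew1 ew2 _ ew4] := is_concatP c.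
pose F u := e (ptgt w) * (ev X (cut u V) * ev G (shift n' (cut u V))) * e (psrc w).
rewrite (sum_tuple_cat _ F eN) [in RHS]eG !ev_pcomp big_distrlr /=.
rewrite pair_big /= pair_big_dep /= big_mkcond [RHS]big_mkcond /=.
apply: eq_bigr => -[u t] _ /=; have su := size_tuple u; have st := size_tuple t.
rewrite /F ev_cut_catl // -[X in shift X]su shift_cut su [in ev G _]eG ev_pcomp_cut //.
have -> : (spells w' u && spells w0 t) = (spells w (u ++ t) && spells w0 t).
  apply/andP/andP => -[o1 o2]; split=> //; first exact: spells_cat o1 o2.
  by rewrite -(spells_catl c o1).
case: ifP => //= _; case: ifP => _; last by rewrite !(mulr0, mul0r).
by rewrite ew4 ew2 -ew1 -!mulrA !vunitKA vunitK.
Qed.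

(** As [sum_cup_pathr], with the word selected by the first factor. *)
Lemma sum_cup_pathl n' n N (F' : C n') (Y : C n) w' w0 w V :
  N = (n' + n)%N -> is_concat w' w0 w -> multilinear F' -> F' = pcomp w' F' ->
  \sum_(u : N.-tuple letter | spells w u)
     e (ptgt w) * (ev F' (cut u V) * ev Y (shift n' (cut u V))) * e (psrc w)
  = ev F' V * ev (pcomp w0 Y) (shift n' V).
Proof.
move=> eN c lF eF; have [ew1 ew2 _ ew4] := is_concatP c.
pose F u := e (ptgt w) * (ev F' (cut u V) * ev Y (shift n' (cut u V))) * e (psrc w).
rewrite (sum_tuple_cat _ F eN) [in RHS]eF !ev_pcomp big_distrlr /=.
rewrite pair_big /= pair_big_dep /= big_mkcond [RHS]big_mkcond /=.
apply: eq_bigr => -[u t] _ /=; have su := size_tuple u; have st := size_tuple t.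
rewrite /F ev_cut_catl // -[X in shift X]su shift_cut su [in ev F' _]eF ev_pcomp_cut //.
have -> : (spells w' u && spells w0 t) = (spells w (u ++ t) && spells w' u).
  apply/andP/andP => -[o1 o2]; split=> //; first exact: spells_cat o1 o2.
  by rewrite (spells_catl c o1).
case: ifP => //= _; case: ifP => _; last by rewrite !(mulr0, mul0r).
by rewrite ew4 ew2 -ew1 -!mulrA !vunitKA.
Qed.

Lemma Kpred_cup n' n (F : C n') (G : C n) w' w0 w :
  is_concat w' w0 w -> Kpred w' F -> Kpred w0 G -> Kpred w (cup F G).
Proof.
move=> c [JF eF] [JG eG]; split; first exact: Jpred_cup.
apply: cochainP => V; rewrite ev_pcomp ev_cup [in LHS]eF.
by rewrite -(sum_cup_pathr _ V erefl c (Jpred_multilinear JG) eG).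
Qed.

Hypothesis noloop : forall a : arr Q, src a <> tgt a.
Hypothesis zeroDelta : zero_compositions Delta.

(** The Leibniz rule of J, projected to w: by [Kd_hochd] the three differentials
    are components of Hochschild coboundaries. *)
Lemma Kd_cup n' n (F : C n') (G : C n) w' w0 w V :
  is_cycle w' -> is_cycle w0 -> is_concat w' w0 w -> Kpred w' F -> Kpred w0 G ->
  ev (Kd w (cup F G)) V = ev (Kd w' F) V * ev G (shift n'.+1 V)
    + (-1) ^+ n' *: (ev F V * ev (Kd w0 G) (shift n' V)).
Proof.
move=> c' c0 c [JF eF] [JG eG]; have [ew1 ew2 _ ew4] := is_concatP c.
have cw : is_cycle w by rewrite /is_cycle ew4 ew2 (eqP c0) -ew1.
rewrite !Kd_hochd //; last exact: Jpred_cup.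
rewrite ev_pcomp lam_sign.
rewrite -(sum_cup_pathr (N := (n' + n).+1) _ V _ c (Jpred_multilinear JG) eG) ?addSn //.
rewrite -(sum_cup_pathl (N := (n' + n).+1) _ V _ c (Jpred_multilinear JF) eF) ?addnS //.
rewrite -sandwich_signed_add; apply: eq_bigr => u _.
by rewrite hochd_cup lam_sign.
Qed.

(** Cutting a word over the cycle w after n' letters gives words over paths w' and
    w0 that are both cycles or both non cycles; in the second case the two values lie
    in M and have product zero. *)
Lemma ev_pcomp_cup n' n (X : C n') (Y : C n) (w : qpath Q) V :
  is_cycle w -> Jpred X -> Jpred Y ->
  ev (pcomp w (cup X Y)) V =
  \sum_(g' : CQ Q n') \sum_(g0 : CQ Q n | is_concat (CQ_path g') (CQ_path g0) w)
    ev (pcomp (CQ_path g') X) V * ev (pcomp (CQ_path g0) Y) (shift n' V).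
Proof.
move=> cw JX JY; pose F u := e (ptgt w) * ev (cup X Y) (cut u V) * e (psrc w).
rewrite ev_pcomp (sum_tuple_cat _ F erefl) pair_big_dep /=.
rewrite [RHS]pair_big_dep /=.
under [RHS]eq_bigr do rewrite !ev_pcomp big_distrlr /= pair_big.
rewrite (exchange_big_dep xpredT) //= big_mkcond /=; apply: eq_bigr => -[u t] _ /=.
have [su st] := (size_tuple u, size_tuple t).
pose F' u t := ev X (cut u V) * ev Y (cut t (shift n' V)).
have FE : F (u ++ t) = e (ptgt w) * F' u t * e (psrc w).
  by rewrite /F ev_cup ev_cut_catl // -[X in shift X]su shift_cut su.
case: ifP => [ow|nw]; last first.
  apply/esym/big1 => -[g' g0] /= /andP[c /andP[o' o0]].
  by move: nw; rewrite (spells_cat c o' o0).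
have [w' [w0 [c o' o0]]] := spells_split ow; have [ew1 ew2 _ ew4] := is_concatP c.
have XE : e (ptgt w) * ev X (cut u V) = ev X (cut u V) * e (psrc w').
  rewrite ew4 -(wtgt_spells o'); apply: balanced_cut => //; first exact: Jpred_balanced.
  by case/andP: o'.
have split_mid : F (u ++ t) =
    (e (ptgt w) * ev X (cut u V) * e (psrc w')) * (e (ptgt w0) * ev Y (cut t (shift n' V)) * e (psrc w0)).
  have XA r : ev X (cut u V) * (e (psrc w') * r) = e (ptgt w) * (ev X (cut u V) * r).
    by rewrite mulrA -XE mulrA.
  by rewrite FE /F' -ew1 -ew2 -!mulrA !vunitKA XA vunitKA.
have cw' : is_cycle w0 -> is_cycle w'.
  by rewrite /is_cycle => /eqP e0; rewrite ew1 -e0 -ew2 -ew4.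
have [c0|nc0] := boolP (is_cycle w0); last first.
  rewrite big1 => [|[g' g0] /= /andP[cg /andP[og' og0]]]; last first.
    have [_ e0] := is_concat_uniq c cg o' o0 og' og0.
    by move: nc0; rewrite e0 CQ_path_cycle.
  rewrite split_mid; apply: mul_inM0 => // x; apply: peirce_off_diag.
    by rewrite -(eqP cw) ew2 ew1; move: nc0.
  by move: nc0; rewrite eq_sym.
have [g0 eg0] := CQ_pathP c0 (leq_trans (size_spells o0) (eq_leq st)).
have [g' eg'] := CQ_pathP (cw' c0) (leq_trans (size_spells o') (eq_leq su)).
rewrite (big_pred1 (g', g0)) => [|[h' h0] /=]; first by rewrite /= eg' eg0 -ew4.
apply/andP/eqP => [[ch /andP[oh' oh0]]|[-> ->]]; last by rewrite eg' eg0 c o' o0.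
have [e' e0] := is_concat_uniq c ch o' o0 oh' oh0.
by congr (_, _); apply: CQ_path_inj; rewrite ?eg' ?eg0.
Qed.

End CupProduct.


(** * Cup products on cohomology classes *)

(** Three complexes with a pairing, so that the result applies both to the
    Hochschild complex and to K_w' x K_w0 -> K_w. *)
Section CupOnClasses.
Variables (k : fieldType) (Q : quiver) (Delta : Qset k Q).
Local Notation C := (cochain Delta).
Variables (d1 d2 d3 : forall n, {linear C n -> C n.+1}).
Variables (P1 P2 P3 : forall n, subspace (C n)).
Local Notation Z := (zsp Delta).
Hypothesis cupP : forall n' n (f : C n') (g : C n), P1 n' f -> P2 n g -> P3 (n' + n)%N (cup f g).
Hypothesis leibniz : forall n' n (f : C n') (g : C n) V, P1 n' f -> P2 n g ->
  ev (d3 _ (cup f g)) V = ev (d1 _ f) V * ev g (shift n'.+1 V)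
    + (-1) ^+ n' *: (ev f V * ev (d2 _ g) (shift n' V)).

Lemma cocycle_cup n' n (f : C n') (g : C n) :
  cocycle d1 P1 Z f -> cocycle d2 P2 Z g -> cocycle d3 P3 Z (cup f g).
Proof.
move=> [Pf df] [Pg dg]; split; first exact: cupP.
apply: cochainP => V; rewrite leibniz // df dg.
by rewrite -[ev 0 V]/0 -[ev 0 (shift n' V)]/0 mul0r mulr0 scaler0 addr0.
Qed.

Lemma coboundary_cupl n' n (f : C n') (g : C n) :
  coboundary d1 P1 Z f -> cocycle d2 P2 Z g -> coboundary d3 P3 Z (cup f g).
Proof.
case: n' f => [|n'] f /= Bf [Pg dg].
  rewrite [f]Bf (_ : cup 0 g = 0); first exact: coboundary_0.
  by apply: cochainP => V; rewrite ev_cup -[ev 0 V]/0 mul0r.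
case: Bf => h Ph /subr0_eq ef; exists (cup h g); first exact: cupP.
apply/eqP; rewrite subr_eq0; apply/eqP; apply: cochainP => V.
rewrite leibniz // dg -[ev 0 _]/0 mulr0 scaler0 addr0.
by rewrite -ef.
Qed.

(** The primitive carries the sign of the Leibniz rule. *)
Lemma coboundary_cupr n' n (f : C n') (g : C n) :
  cocycle d1 P1 Z f -> coboundary d2 P2 Z g -> coboundary d3 P3 Z (cup f g).
Proof.
move=> [Pf df]; case: n g => [|n] g /= Bg.
  rewrite [g]Bg (_ : cup f 0 = 0); first exact: coboundary_0.
  by apply: cochainP => V; rewrite ev_cup -[ev 0 _]/0 mulr0.
case: Bg => h Ph /subr0_eq eg.
(* The degree n' + n.+1 has to be put in the form of a successor. *)
suff E N (eN : N = (n' + n).+1) (F : C N) :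
    (forall V, ev F V = ev f V * ev g (shift n' V)) -> coboundary d3 P3 Z F.
  exact: (E _ (addnS n' n)).
subst N => EF; exists ((-1) ^+ n' *: cup f h); first by apply/subspaceZ/cupP.
apply/eqP; rewrite subr_eq0 linearZ; apply/eqP; apply: cochainP => V.
rewrite -[ev (_ *: _) V]/((-1) ^+ n' *: ev (d3 _ (cup f h)) V) leibniz // df.
rewrite -[ev 0 V]/0 mul0r add0r scalerA -exprD addnn -muln2 mulnC exprM sqrrN !expr1n scale1r.
by rewrite EF eg.
Qed.

(** f g - f' g' = (f - f') g + f' (g - g'), and each summand is a coboundary. *)
Lemma hclass_cup n' n (f f' : C n') (g g' : C n) :
  cocycle d1 P1 Z f -> cocycle d1 P1 Z f' -> cocycle d2 P2 Z g -> cocycle d2 P2 Z g' ->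
  coboundary d1 P1 Z (f - f') -> coboundary d2 P2 Z (g - g') ->
  hclass d3 P3 Z (cup f g) = hclass d3 P3 Z (cup f' g').
Proof.
move=> Zf Zf' Zg Zg' Bf Bg; apply/hclassP; try exact: cocycle_cup.
rewrite (_ : cup f g - cup f' g' = 1 *: cup (f - f') g + cup f' (g - g')).
  apply: coboundary_lin; first exact: coboundary_cupl.
  exact: coboundary_cupr.
apply: cochainP => V; rewrite scale1r.
rewrite -[LHS]/(ev f V * ev g (shift n' V) - ev f' V * ev g' (shift n' V)).
rewrite -[RHS]/((ev f V - ev f' V) * ev g (shift n' V) + ev f' V * (ev g (shift n' V) - ev g' (shift n' V))).
by rewrite mulrBl mulrBr addrA subrK.
Qed.

End CupOnClasses.

(** * The maps iota and pi *)
Section IotaPi.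
Variables (k : fieldType) (Q : quiver) (Delta : Qset k Q).
Local Notation C := (cochain Delta).
Local Notation e := (vunit Delta).
Local Notation pcomp := Defs.pcomp.
Local Notation J := (Jsp Delta).
Local Notation Z := (zsp Delta).
Local Notation D := (Dsp Delta).
Local Notation d := (hochd_lin Delta).

Lemma HHcup_hclass n' n (f : C n') (g : C n) :
  cocycle d J Z f -> cocycle d J Z g ->
  HHcup (hclass d J Z f) (hclass d J Z g) = hclass d J Z (cup f g).
Proof.
move=> Zf Zg; apply: (hclass_cup (d1 := d) (d2 := d) (P1 := J) (P2 := J)) => //.
- by move=> m' m F G; apply: Jpred_cup.
- by move=> m' m F G V _ _; apply: hochd_cup.
- exact: hrep_cocycle.
- exact: hrep_cocycle.
- exact: hrep_hclass.
- exact: hrep_hclass.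
Qed.

Lemma HHcup_cocycle n' n (f : C n') (g : C n) :
  cocycle d J Z f -> cocycle d J Z g -> cocycle d J Z (cup f g).
Proof.
apply: cocycle_cup; first by move=> m' m F G; apply: Jpred_cup.
by move=> m' m F G V _ _; apply: hochd_cup.
Qed.

(** Cochains in D^n have values in M: the ends of a non cycle differ. *)
Lemma Dpred_in_M n (f : C n) V x : Dpred f -> (ev f V).1 x = 0.
Proof.
move=> [_ ef]; rewrite ef ev_sum.
rewrite sum_fstE big1 // => w _; rewrite ev_pcomp sum_fstE big1 // => u _.
by apply: peirce_off_diag; have := valP w; rewrite eq_sym.
Qed.

Hypothesis noloop : forall a : arr Q, src a <> tgt a.
Hypothesis zeroDelta : zero_compositions Delta.

Lemma cup_Dpred n' n (f' : C n') (f : C n) : Dpred f' -> Dpred f -> cup f' f = 0.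
Proof.
move=> Df' Df; apply: cochainP => V; rewrite ev_cup.
by apply: mul_inM0 => // x; apply: Dpred_in_M.
Qed.

(** The chosen representative of a class in H(D) serves in HH as well. *)
Lemma iota_rep n (h : sumDQ Delta n) :
  exists2 f : C n, Dpred f /\ hochd f = 0 & iota_map h = hclass d J Z f.
Proof.
by have [Df df] := hrep_cocycle (sumDQ_to_HD h); exists (hrep (sumDQ_to_HD h)).
Qed.

Lemma cup_iota n' n (x : sumDQ Delta n') (y : sumDQ Delta n) :
  HHcup (iota_map x) (iota_map y) = 0.
Proof.
have [f [Df df] ->] := iota_rep x; have [g [Dg dg] ->] := iota_rep y.
have Z_of m (h : C m) : Dpred h -> hochd h = 0 -> cocycle d J Z h by move=> [Jh _] dh.
rewrite HHcup_hclass ?cup_Dpred; try exact: Z_of; try by [].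
exact: hclass0.
Qed.

Lemma cocycle_JD n (f : C n) : cocycle d J Z f -> cocycle d J D f.
Proof. by case=> Jf df; split=> //; rewrite df; apply: subspace_0. Qed.

Lemma coboundary_JD n (f : C n) : coboundary d J Z f -> coboundary d J D f.
Proof.
case: n f => [|n] f /=; first by move=> ->; apply: Dpred_0.
by move=> [h Jh ef]; exists h => //; rewrite ef; apply: Dpred_0.
Qed.

Lemma Kpred_pcomp n w (f : C n) : Jpred f -> Kpred w (pcomp w f).
Proof.
by move=> Jf; split; [apply: Jpred_pcomp | rewrite pcomp_id //; apply: Jpred_multilinear].
Qed.

Lemma Kd_pcomp n w (f : C n) : is_cycle w -> Jpred f -> Kd w (pcomp w f) = pcomp w (hochd f).
Proof.
move=> cw Jf; rewrite -Kd_hochd //; apply: eq_bigr => p pT; apply: eq_bigr => i _.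
by rewrite tcomp_pcomp //; apply: Jpred_multilinear.
Qed.

Lemma pcomp_cycle_Dpred n w (f : C n) : is_cycle w -> Dpred f -> pcomp w f = 0.
Proof.
move=> cw [Jf ->]; rewrite linear_sum big1 // => w' _.
apply: pcomp_orth; first exact: Jpred_multilinear.
by move=> eww'; have := valP w'; rewrite -/(DQ_path w') -eww' cw.
Qed.

Section Cycle.
Variables (w : qpath Q) (cw : is_cycle w).
Local Notation dw := (Kd_lin Delta w).
Local Notation K := (Ksp Delta w).

(** With [pcomp_coboundary]: taking the component over the cycle w is a map of
    complexes from J/D to K_w. *)
Lemma pcomp_cocycle n (f : C n) : cocycle d J D f -> cocycle dw K Z (pcomp w f).
Proof.
move=> [Jf Ddf]; split; first exact: Kpred_pcomp.
by rewrite /= Kd_pcomp // pcomp_cycle_Dpred.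
Qed.

Lemma pcomp_coboundary n (f : C n) : coboundary d J D f -> coboundary dw K Z (pcomp w f).
Proof.
case: n f => [|n] f /=; first by move=> Df; rewrite /= pcomp_cycle_Dpred.
move=> [h Jh Dfh]; exists (pcomp w h); first exact: Kpred_pcomp.
by rewrite /= Kd_pcomp // -raddfB; apply: pcomp_cycle_Dpred.
Qed.

(** pi passes through chosen representatives in J and in J/D; both are cohomologous
    to f modulo D. *)
Lemma hclass_pcomp_hrep n (f : C n) : cocycle d J Z f ->
  hclass dw K Z (pcomp w (hrep (HH_to_HJD (hclass d J Z f)))) = hclass dw K Z (pcomp w f).
Proof.
move=> Zf; set h := hclass d J Z f; have Zh := hrep_cocycle h.
apply/hclassP; [exact/pcomp_cocycle/hrep_cocycle | exact/pcomp_cocycle/cocycle_JD |].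
rewrite -raddfB; apply: pcomp_coboundary.
have B1 := hrep_hclass (cocycle_JD Zh); have B2 := coboundary_JD (hrep_hclass Zf).
rewrite -(subrK (hrep h) (hrep _)) -addrA -[X in X + _]scale1r.
exact: coboundary_lin.
Qed.

End Cycle.

Lemma pi_hclass n (f : C n) (g : CQ Q n) : cocycle d J Z f ->
  pi_map (hclass d J Z f) g =
  hclass (Kd_lin Delta (CQ_path g)) (Ksp Delta (CQ_path g)) Z (pcomp (CQ_path g) f).
Proof. by move=> Zf; apply: hclass_pcomp_hrep => //; apply: CQ_path_cycle. Qed.

Lemma pi_linear n : linear (@pi_map k Q Delta n).
Proof.
move=> c x y; apply: dprodP => g.
have [Zx Zy] := (hrep_cocycle x, hrep_cocycle y).
rewrite -{1}[x]hrepK -{1}[y]hrepK -hclass_linear // pi_hclass; last exact: cocycle_lin.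
rewrite linearP hclass_linear; try by apply: pcomp_cocycle; [apply: CQ_path_cycle|apply: cocycle_JD].
have Ex := pi_hclass g Zx; have Ey := pi_hclass g Zy; rewrite !hrepK in Ex Ey.
by rewrite -[RHS]/(c *: pi_map x g + pi_map y g) Ex Ey.
Qed.

Lemma one_cocycle : cocycle d J Z ((fun=> 1) : C 0).
Proof.
split; first split=> //; try by move=> v [].
  by move=> v d0 _ _; rewrite mul1r mulr1.
apply: cochainP => V; rewrite -[LHS]/(ev (hochd _) V) ev_hochd big_ord0 addr0 expr1 scaleN1r.
by rewrite -[ev _ (shift 1 V)]/1 -[ev _ V]/1 mulr1 mul1r subrr.
Qed.

Lemma pi_one : pi_map (HHone Delta) = sumCQ_one Delta.
Proof.
apply: dprodP => g; rewrite pi_hclass; last exact: one_cocycle.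
rewrite /sumCQ_one; congr hclass; apply: cochainP => V; rewrite ev_pcomp.
have lg : parr (CQ_path g) = [::].
  by apply: size0nil; apply/eqP; rewrite -leqn0; apply: (valP (val (val g)).2).
rewrite (big_pred1 [tuple]) => [|u]; last by rewrite tuple0 [RHS]eqxx /spells lg.
rewrite -[ev _ _]/1 mulr1 -[RHS]/(e (psrc (CQ_path g))).
by rewrite -(eqP (CQ_path_cycle g)) vunitK.
Qed.

Lemma cocycle_path_cup w' w0 w n' n (F : C n') (G : C n) :
  is_cycle w' -> is_cycle w0 -> is_concat w' w0 w ->
  cocycle (Kd_lin Delta w') (Ksp Delta w') Z F ->
  cocycle (Kd_lin Delta w0) (Ksp Delta w0) Z G ->
  cocycle (Kd_lin Delta w) (Ksp Delta w) Z (cup F G).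
Proof.
move=> c' c0 c; apply: cocycle_cup => [m' m F1 G1|m' m F1 G1 V]; first exact: Kpred_cup.
by move=> KF KG; apply: Kd_cup.
Qed.

Lemma path_cup_hclass w' w0 w n' n (F : C n') (G : C n) :
  is_cycle w' -> is_cycle w0 -> is_concat w' w0 w ->
  cocycle (Kd_lin Delta w') (Ksp Delta w') Z F ->
  cocycle (Kd_lin Delta w0) (Ksp Delta w0) Z G ->
  path_cup w (hclass (Kd_lin Delta w') (Ksp Delta w') Z F)
             (hclass (Kd_lin Delta w0) (Ksp Delta w0) Z G)
  = hclass (Kd_lin Delta w) (Ksp Delta w) Z (cup F G).
Proof.
move=> c' c0 c ZF ZG; rewrite /path_cup c.
apply: (hclass_cup (d1 := Kd_lin Delta w') (d2 := Kd_lin Delta w0)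
                   (P1 := Ksp Delta w') (P2 := Ksp Delta w0)) => //.
- by move=> m' m F1 G1; apply: Kpred_cup.
- by move=> m' m F1 G1 V KF KG; apply: Kd_cup.
- exact: hrep_cocycle.
- exact: hrep_cocycle.
- exact: hrep_hclass.
- exact: hrep_hclass.
Qed.

Lemma pi_cup n' n (x : HH Delta n') (y : HH Delta n) :
  pi_map (HHcup x y) = sumCQ_cup (pi_map x) (pi_map y).
Proof.
apply: dprodP => g; have [Zx Zy] := (hrep_cocycle x, hrep_cocycle y).
set X := hrep x in Zx; set Y := hrep y in Zy.
rewrite -[x]hrepK -[y]hrepK -/X -/Y HHcup_hclass // pi_hclass; last exact: HHcup_cocycle.
have -> : pcomp (CQ_path g) (cup X Y) = \sum_(g' : CQ Q n')
    \sum_(g0 : CQ Q n | is_concat (CQ_path g') (CQ_path g0) (CQ_path g))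
      cup (pcomp (CQ_path g') X) (pcomp (CQ_path g0) Y).
  apply: cochainP => V.
  rewrite (ev_pcomp_cup zeroDelta _ (CQ_path_cycle g) Zx.1 Zy.1) ev_sum.
  by apply: eq_bigr => g' _; rewrite [RHS]ev_sum; apply: eq_bigr => g0 _; rewrite ev_cup.
have cyc n0 (h : CQ Q n0) := CQ_path_cycle h.
have ZX (g' : CQ Q n') := pcomp_cocycle (cyc _ g') (cocycle_JD Zx).
have ZY (g0 : CQ Q n) := pcomp_cocycle (cyc _ g0) (cocycle_JD Zy).
have Zcup (g' : CQ Q n') (g0 : CQ Q n) : is_concat (CQ_path g') (CQ_path g0) (CQ_path g) ->
    cocycle (Kd_lin Delta (CQ_path g)) (Ksp Delta (CQ_path g)) Z
      (cup (pcomp (CQ_path g') X) (pcomp (CQ_path g0) Y)).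
  by move=> c; apply: cocycle_path_cup (cyc _ g') (cyc _ g0) c _ _.
rewrite hclass_sum => [|g' _]; last first.
  by apply: cocycle_sum => g0; apply: Zcup.
rewrite /sumCQ_cup; apply: eq_bigr => g' _.
rewrite hclass_sum => [|g0 c]; last exact: Zcup.
rewrite big_mkcond; apply: eq_bigr => g0 _.
rewrite (pi_hclass g' Zx) (pi_hclass g0 Zy); case: ifP => c; last by rewrite /path_cup c.
exact: esym (path_cup_hclass (cyc _ g') (cyc _ g0) c (ZX g') (ZY g0)).
Qed.

End IotaPi.

Theorem theorem6p5 (k : fieldType) (Q : quiver) (Delta : Qset k Q)
    (slQ : simply_laced Q) (zeroDelta : zero_compositions Delta) :
  ((forall (n' n : nat) (x : sumDQ Delta n') (y : sumDQ Delta n),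
      HHcup (iota_map x) (iota_map y) = 0) /\
   (forall (n' n : nat) (f' : cochain Delta n') (f : cochain Delta n),
      Dpred f' -> hochd f' = 0 -> Dpred f -> hochd f = 0 -> cup f' f = 0)) /\
  ((forall n : nat, linear (@pi_map k Q Delta n)) /\
   pi_map (HHone Delta) = sumCQ_one Delta /\
   (forall (n' n : nat) (x : HH Delta n') (y : HH Delta n),
      pi_map (HHcup x y) = sumCQ_cup (pi_map x) (pi_map y))).
Proof.
have noloop := slQ.1; do 3?split.
- by move=> n' n x y; apply: cup_iota.
- by move=> n' n f' f Df' _ Df _; apply: cup_Dpred.
- by move=> n; apply: pi_linear.
- exact: pi_one.
- by move=> n' n x y; apply: pi_cup.
Qed.
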